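(* Let $p$ be a prime number, $\nu,\eta\in\mathbb{N}$ with $0<\nu\le\eta\le2\nu$, $u=p^{\nu}$, $v=p^{\eta}$, $t=p^{\eta-\nu}$, $u'=p^{2\nu-\eta}$, and assume $2<u<v\le u^2$. Let $\mathcal{A}=(\mathbb{Z}/v\mathbb{Z};\cdot)$ with $\imath\cdot\jmath:=(1-u\imath)\jmath$, and let $\Gamma$ be an additive abelian group. Then $$\mathrm{H}^2_N(\mathcal{A},\Gamma)\cong\mathrm{H}^2(\mathcal{X}(\mathcal{A},\Gamma))\cong\frac{\Gamma}{u\Gamma}\oplus\Gamma_{u}.$$ Moreover, for $\gamma,\gamma_1\in\Gamma$ with $v\gamma_1=u\gamma$ put $z(\gamma_1,\gamma):=\bigl(f_1(\gamma),\ \imath\mapsto\gamma_{\imath},\ \imath\mapsto-\imath(t\gamma_1-\gamma)\bigr)$, where $(\gamma_{\imath})$ is the $v$-periodic family determined by $\gamma_1,\gamma$ described in the context. Then the set $\overline{Z}:=\{z(\gamma_1,\gamma):v\gamma_1=u\gamma\}$ is a subgroup of the group $Z$ of $2$-cocycles of $\mathcal{X}(\mathcal{A},\Gamma)$, it maps surjectively onto $\mathrm{H}^2(\mathcal{X}(\mathcal{A},\Gamma))=Z/B$, and $B\cap\overline{Z}=\{z(u\gamma,v\gamma):\gamma\in\Gamma\}$. Finally, the map $\Theta\colon\overline{Z}\to\Gamma\oplus\Gamma_{u}$, $\Theta(z(\gamma_1,\gamma)):=(\gamma_1,t\gamma_1-\gamma)$, is an isomorphism that induces an isomorphism $\ma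thrm{H}^2(\mathcal{X}(\mathcal{A},\Gamma))\cong\Gamma/u\Gamma\oplus\Gamma_{u}$.
   Context: For $r\in\mathbb{N}$, $\Gamma_r:=\{\gamma\in\Gamma:r\gamma=0\}$. $C_v=\langle g\rangle$ is the multiplicative cyclic group of order $v$ with $g^{\imath}\cdot g^{\jmath}:=g^{(1-u\imath)\jmath}$; $D=\mathbb{Z}[C_v]$, $\overline{D}=D/\mathbb{Z}1$. Normalized full cohomology $\mathrm{H}^*_N(\mathcal{A},\Gamma)$. For $s\ge1$ let $\overline{M}(s)$ be the quotient of $\overline{D}^{\otimes s}$ by the subgroup generated by the shuffles $\sum_{\sigma}\mathrm{sg}(\sigma)\,d_{\sigma^{-1}(1)}\otimes\cdots\otimes d_{\sigma^{-1}(s)}$, where $1\le l<s$, $d_k\in\overline{D}$ and $\sigma$ runs over the permutations with $\sigma(1)<\dots<\sigma(l)$ and $\sigma(l+1)<\dots<\sigma(s)$; $[\cdots]$ denotes classes. For $r\ge0,s\ge1$ let $\widehat{C}_{rs}=\overline{D}^{\otimes r}\otimes\overline{M}(s)$, with horizontal differential $\partial^{\mathrm h}(g_1\otimes\cdots\otimes g_r\otimes[g_{r+1}\otimes\cdots\otimes g_{r+s}])=g_1\cdot g_2\otimes\cdots\otimes g_1\cdot g_r\otimes[g_1\cdot g_{r+1}\otimes\cdots\otimes g_1\cdot g_{r+s}]+\sum_{j=1}^{r-1}(-1)^jg_1\otimes\cdots\otimes g_jg_{j+1}\otimes\cdots\otimes g_r\otimes[g_{r+1}\otimes\cdots\otimes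 g_{r+s}]+(-1)^rg_1\otimes\cdots\otimes g_{r-1}\otimes[g_{r+1}\otimes\cdots\otimes g_{r+s}]$ and vertical differential $\partial^{\mathrm v}(g_1\otimes\cdots\otimes g_r\otimes[g_{r+1}\otimes\cdots\otimes g_{r+s}])=(-1)^{r+1}g_1\otimes\cdots\otimes g_r\otimes[g_{r+2}\otimes\cdots\otimes g_{r+s}]+\sum_{j=r+1}^{r+s-1}(-1)^{j+1}g_1\otimes\cdots\otimes g_r\otimes[g_{r+1}\otimes\cdots\otimes g_jg_{j+1}\otimes\cdots\otimes g_{r+s}]+(-1)^{r+s+1}g_1\otimes\cdots\otimes g_r\otimes[g_{r+1}\otimes\cdots\otimes g_{r+s-1}]$. Then $\mathrm{H}^n_N(\mathcal{A},\Gamma)$ is the $n$-th cohomology of $\mathrm{Hom}_{\mathbb{Z}}(\mathrm{Tot}(\widehat{C}_{**}),\Gamma)$, where $\mathrm{Tot}_n=\bigoplus_{r+s=n}\widehat{C}_{rs}$ has differential $\partial^{\mathrm h}+\partial^{\mathrm v}$. The small complex $\mathcal{X}(\mathcal{A},\Gamma)$ in degree $2$. Its $1$-cochains are functions $\theta\colon\mathbb{Z}/v\to\Gamma$ with $\theta(0)=0$; its $2$-cochains are triples $(F,\alpha,\beta)$ with $F\colon\mathbb{Z}/v\times\mathbb{Z}/v\to\Gamma$ symmetric, $F(0,\cdot)=0$, and $\alpha,\beta\colon\mathbb{Z}/v\to\Gamma$ with $\alpha(0)=\beta(0)=0$. The group $B$ of $2$-coboundaries consists of the triples $\bigl((\imath,\jmath)\mapsto\theta(\imath+\jmath)-\theta(\imath)-\theta(\jmath),\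 \imath\mapsto\theta((1-u)\imath)-\theta(\imath),\ 0\bigr)$. The group $Z$ of $2$-cocycles consists of the triples satisfying, for all $a,b,c,\imath,\jmath\in\mathbb{Z}/v$: $F(b,c)-F(a+b,c)+F(a,b+c)-F(a,b)=0$; $\alpha(\imath)+\alpha(\jmath)-\alpha(\imath+\jmath)+F((1-u)\imath,(1-u)\jmath)-F(\imath,\jmath)=0$; $\beta(\imath+\jmath)=\beta(\imath)+\beta(\jmath)$; $\beta((1-u)\imath)=\beta(\imath)$; $u\beta(\imath)=0$; and $-\sum_{s=0}^{t-1}\alpha((1-su)\imath)-\beta(\imath)+u'\sum_{s=1}^{t-1}s\,\beta((1-su)\imath)=0$. $\mathrm{H}^2(\mathcal{X}(\mathcal{A},\Gamma))=Z/B$. For $\gamma\in\Gamma$, $f_1(\gamma)$ is the function on $\mathbb{Z}/v\times\mathbb{Z}/v$ given on representatives $0\le\imath,\jmath<v$ by $\gamma$ if $\imath=\jmath=1$, by $-\gamma$ if $\imath,\jmath\ge2$ and $\imath+\jmath\le v+1$, and by $0$ otherwise. The family $(\gamma_r)_{r\in\mathbb{Z}}$: it is $v$-periodic in $r$, $\gamma_0=0$, $\gamma_1$ is the given element, and for $2\le r<v$ one sets $\gamma_{kt+l}=(kt+l)\gamma_1-(k+1)\gamma$, where $r=kt+l$ is written with $(k,l)$ in the following ranges. If $v=u^2$ (i.e. $t=u$): $k=0$ and $2\le l\le t$; or $k=1$ and $1\le l\le t+2$; or $2\le k<t-1$ and $k<l\le t+k+1$. If $v<u^2$ (i.e. $1<t<u$):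 $k=0$ and $2\le l\le t$; or $1\le k<u'$ and $1\le l\le t$; or $k=u'$ and $1\le l\le t+1$; or $u'<k\le 2u'-2$ and $2\le l\le t+1$; or $k=hu'-1$ and $h\le l\le t+h$ for some $2\le h<t$; or $hu'\le k\le(h+1)u'-2$ and $h<l\le t+h$ for some $2\le h<t$. *)

(* Defs.v *)
From HB Require Import structures.
From mathcomp Require Import all_boot all_fingroup all_algebra.
From mathcomp Require Import boolp classical_sets functions.

Set Implicit Arguments.
Unset Strict Implicit.
Unset Printing Implicit Defensive.

Import GRing.Theory.
Local Open Scope ring_scope.
Local Open Scope quotient_scope.

Lemma subD (V : zmodType) (a b c d : V) : (a - b) + (c - d) = (a + c) - (b + d).
Proof. by rewrite addrACA -opprD. Qed.

Lemma subB (V : zmodType) (a b c d : V) : (a - b) - (c - d) = (a - c) - (b - d).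
Proof. by rewrite !opprB !subD [c + b]addrC. Qed.

Section Subgroups.
Variable V : zmodType.

Definition gen_pred (S : V -> Prop) : {pred V} :=
  [pred x : V | `[< forall P : zmodClosed V,
                      (forall s, S s -> s \in P) -> x \in P >]].

Lemma gen_closed S : zmod_closed (gen_pred S).
Proof.
split=> [|x y /asboolP xS /asboolP yS]; apply/asboolP=> P SP; first exact: rpred0.
by rewrite rpredB ?xS ?yS.
Qed.
HB.instance Definition _ S := GRing.isZmodClosed.Build V (gen_pred S) (gen_closed S).

(* the subgroup of V generated by S *)
Definition gen (S : V -> Prop) : zmodClosed V := gen_pred S.

Definition torsion_pred (r : nat) : {pred V} := [pred x : V | x *+ r == 0].

Lemma torsion_closed r : zmod_closed (torsion_pred r).
Proof.
split=> [|x y]; rewrite !inE ?mul0rn // => /eqP xr /eqP yr.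
by rewrite mulrnBl xr yr subrr.
Qed.
HB.instance Definition _ r :=
  GRing.isZmodClosed.Build V (torsion_pred r) (torsion_closed r).

Definition multiples_pred (r : nat) : {pred V} :=
  [pred x : V | `[< exists y, x = y *+ r >]].

Lemma multiples_closed r : zmod_closed (multiples_pred r).
Proof.
split=> [|x y /asboolP[a ->] /asboolP[b ->]]; apply/asboolP.
  by exists 0; rewrite mul0rn.
by exists (a - b); rewrite mulrnBl.
Qed.
HB.instance Definition _ r :=
  GRing.isZmodClosed.Build V (multiples_pred r) (multiples_closed r).

Section Subquotient.
Variable Z : zmodClosed V.

Record subgp := Subgp { subgp_val : V; _ : subgp_val \in Z }.
HB.instance Definition _ := [isSub for subgp_val].
HB.instance Definition _ := [Choice of subgp by <:].
HB.instance Definition _ := [SubChoice_isSubZmodule of subgp by <:].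

Variable B : zmodClosed V.

Definition restr_pred : {pred subgp} := [pred x : subgp | val x \in B].

Lemma restr_closed : zmod_closed restr_pred.
Proof.
split=> [|x y]; rewrite !inE ?raddf0 ?rpred0 //.
by move=> xB yB; rewrite raddfB rpredB.
Qed.
HB.instance Definition _ :=
  GRing.isZmodClosed.Build subgp restr_pred restr_closed.

(* Z / (B :&: Z), which is Z / B since B is contained in Z in all uses *)
Definition subquot := Quotient.quot restr_pred.
HB.instance Definition _ := GRing.Zmodule.on subquot.
HB.instance Definition _ := EqQuotient.on subquot.
Definition subquot_class (x : subgp) : subquot := \pi_subquot x.
End Subquotient.
End Subgroups.

Definition torsion (V : zmodType) (r : nat) : zmodType := subgp (@torsion_pred V r).
Definition quo_multiples (V : zmodType) (r : nat) : zmodType :=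
  Quotient.quot (@multiples_pred V r).
Definition quo_multiples_class (V : zmodType) (r : nat) (x : V) : quo_multiples V r :=
  \pi_(Quotient.quot (@multiples_pred V r)) x.

Definition zmod_isog (V W : zmodType) := exists f : {additive V -> W}, bijective f.

Section DirectSum.
Variables (I : finType) (V : I -> zmodType).

Definition dsum := forall i, V i.
HB.instance Definition _ := Choice.on dsum.

Definition dsum_zero : dsum := fun i => 0.
Definition dsum_opp (x : dsum) : dsum := fun i => - x i.
Definition dsum_add (x y : dsum) : dsum := fun i => x i + y i.

Lemma dsum_addA : associative dsum_add.
Proof. by move=> x y z; apply/functional_extensionality_dep=> i; apply: addrA. Qed.
Lemma dsum_addC : commutative dsum_add.
Proof. by move=> x y; apply/functional_extensionality_dep=> i; apply: addrC. Qed.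
Lemma dsum_add0 : left_id dsum_zero dsum_add.
Proof. by move=> x; apply/functional_extensionality_dep=> i; apply: add0r. Qed.
Lemma dsum_addN : left_inverse dsum_zero dsum_opp dsum_add.
Proof. by move=> x; apply/functional_extensionality_dep=> i; apply: addNr. Qed.
HB.instance Definition _ :=
  GRing.isZmodule.Build dsum dsum_addA dsum_addC dsum_add0 dsum_addN.
End DirectSum.

(* The finite abelian group C is written additively: i : 'Z_v stands for g ^ i   *)
(* in C_v, and 0 : C for the identity 1 of C_v.  Tensor powers of D = Z[C] are   *)
(* identified with Z[C^n], the basis element of x : {ffun 'I_n -> C} being       *)
(* x_1 (x) ... (x) x_n; positions are numbered from 0 in 'I_n.                   *)
Section FullCohomology.
Variables (C : finZmodType) (dot : C -> C -> C).

Definition tens_pow (n : nat) : zmodType := {ffun {ffun 'I_n -> C} -> int}.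

Definition basis n (x : {ffun 'I_n -> C}) : tens_pow n := [ffun y => (y == x)%:R].

Definition pure n (d : 'I_n -> {ffun C -> int}) : tens_pow n :=
  [ffun x : {ffun 'I_n -> C} => \prod_i d i (x i)].

(* permutations fixing the positions < r and increasing on the next l positions  *)
(* and on the remaining ones                                                     *)
Definition is_shuffle n (r l : nat) (s : 'S_n) : bool :=
  [forall i : 'I_n, (i < r)%N ==> (s i == i)] &&
  [forall i : 'I_n, forall j : 'I_n,
     [&& i < j & [&& r <= i & j < r + l] || (r + l <= i)]%N ==> (s i < s j)%N].

(* The kernel of the projection of D^{(x) n} onto Dbar^{(x) r} (x) Mbar(n - r):  *)
(* (x) being right exact, it is generated by the pure tensors with a factor in   *)
(* Z1 and by the shuffles of the last n - r factors.                             *)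
Definition tens_rel n (r : nat) (c : tens_pow n) : Prop :=
  (exists (d : 'I_n -> {ffun C -> int}) (i : 'I_n) (k : int),
     d i = [ffun a => (a == 0)%:R * k] /\ c = pure d) \/
  (exists (d : 'I_n -> {ffun C -> int}) (l : nat),
     [/\ (1 <= l)%N, (r + l < n)%N &
         c = \sum_(s : 'S_n | is_shuffle r l s)
               pure (fun i => d ((s^-1)%g i)) *~ (-1) ^+ s]).

(* Chat n r is the group usually indexed by (r, s) with r + s = n. *)
Definition Chat n (r : nat) : zmodType := Quotient.quot (gen (@tens_rel n r)).
Definition Chat_class n r (c : tens_pow n) : Chat n r :=
  \pi_(Quotient.quot (gen (@tens_rel n r))) c.

Definition Tot n : zmodType := dsum (fun r : 'I_n => Chat n r).

(* x_1 (x) ... (x) x_r (x) [x_{r+1} (x) ... (x) x_n] *)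
Definition generator n (r : 'I_n) (x : {ffun 'I_n -> C}) : Tot n :=
  fun q => if q == r then Chat_class q (basis x) else 0.

Section Faces.
Variables (n : nat) (x : {ffun 'I_n.+1 -> C}).

(* x_1 . x_2, ..., x_1 . x_{n+1} *)
Definition act_first : {ffun 'I_n -> C} :=
  [ffun i : 'I_n => dot (x ord0) (x (lift ord0 i))].

(* x_1, ..., x_j x_{j+1}, ..., x_{n+1}, with 1 <= j <= n *)
Definition merge (j : nat) : {ffun 'I_n -> C} :=
  [ffun i : 'I_n => if (i.+1 < j)%N then x (inord i)
                    else if i.+1 == j then x (inord i) + x (inord i.+1)
                    else x (inord i.+1)].

(* x_1, ..., x_{n+1} without x_j, with 1 <= j <= n + 1 *)
Definition omit (j : nat) : {ffun 'I_n -> C} :=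
  [ffun i : 'I_n => if (i.+1 < j)%N then x (inord i) else x (inord i.+1)].

Definition bd_h (r : nat) : tens_pow n :=
  basis act_first + \sum_(1 <= j < r) basis (merge j) *~ (-1) ^+ j
  + basis (omit r) *~ (-1) ^+ r.

(* here r + s = n + 1 *)
Definition bd_v (r : nat) : tens_pow n :=
  basis (omit r.+1) *~ (-1) ^+ r.+1
  + \sum_(r.+1 <= j < n.+1) basis (merge j) *~ (-1) ^+ j.+1
  + basis (omit n.+1) *~ (-1) ^+ n.+2.

(* bd_h + bd_v on a generator of Tot_{n+1}; the horizontal part is absent for    *)
(* r = 0, the vertical one for s = 1.                                            *)
Definition boundary (r : 'I_n.+1) : Tot n :=
  fun q => (if q.+1 == r :> nat then Chat_class q (bd_h r) else 0)
           + (if q == r :> nat then Chat_class q (bd_v r) else 0).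
End Faces.

Variable G : zmodType.

Definition Hom_pred n : {pred Tot n -> G} :=
  [pred f : Tot n -> G | `[< forall x y, f (x - y) = f x - f y >]].

(* b is the composite of f with the differential Tot_{n+1} -> Tot_n; both are    *)
(* homomorphisms on Tot_{n+1}, hence compared on generators.                     *)
Definition is_coboundary n (f : Tot n -> G) (b : Tot n.+1 -> G) : Prop :=
  forall r x, b (generator r x) = f (boundary x r).

Definition Zpred n : {pred Tot n -> G} :=
  [pred f : Tot n -> G | (f \in @Hom_pred n) && `[< is_coboundary f 0 >]].

Definition Bpred n : {pred Tot n -> G} :=
  match n with
  | 0 => [pred f : Tot 0 -> G | f == 0]
  | m.+1 => [pred b : Tot m.+1 -> G | (b \in @Hom_pred m.+1) &&
              `[< exists f : Tot m -> G, f \in @Hom_pred m /\ is_coboundary f b >]]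
  end.

Lemma Hom_closed n : zmod_closed (@Hom_pred n).
Proof.
split=> [|f g /asboolP fH /asboolP gH]; apply/asboolP=> x y /=.
  by rewrite subrr.
change (f (x - y) - g (x - y) = (f x - g x) - (f y - g y)).
by rewrite fH gH subB.
Qed.
HB.instance Definition _ n :=
  GRing.isZmodClosed.Build (Tot n -> G) (@Hom_pred n) (@Hom_closed n).

Lemma Zpred_closed n : zmod_closed (@Zpred n).
Proof.
have ZE f : (f \in @Zpred n) = (f \in @Hom_pred n) && `[< is_coboundary f 0 >] by [].
split=> [|f g]; rewrite !ZE; first by rewrite rpred0; apply/asboolP.
move=> /andP[fH /asboolP fZ] /andP[gH /asboolP gZ]; rewrite rpredB //=.
apply/asboolP=> r x; change (0 = f (boundary x r) - g (boundary x r)).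
by rewrite -fZ -gZ subrr.
Qed.
HB.instance Definition _ n :=
  GRing.isZmodClosed.Build (Tot n -> G) (@Zpred n) (@Zpred_closed n).

Lemma Bpred_closed n : zmod_closed (@Bpred n).
Proof.
case: n => [|n].
  split=> [|f g]; first by apply/eqP.
  by move=> /eqP f0 /eqP g0; apply/eqP; rewrite f0 g0 subrr.
have BE b : (b \in @Bpred n.+1) = (b \in @Hom_pred n.+1) &&
  `[< exists f : Tot n -> G, f \in @Hom_pred n /\ is_coboundary f b >] by [].
split=> [|f g]; rewrite !BE.
  by rewrite rpred0; apply/asboolP; exists 0; split=> //; exact: rpred0.
move=> /andP[fH /asboolP[f' [f'H ff]]] /andP[gH /asboolP[g' [g'H gg]]].
rewrite rpredB //=; apply/asboolP; exists (f' - g'); split; first exact: rpredB.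
move=> r x; change (f (generator r x) - g (generator r x) =
  f' (boundary x r) - g' (boundary x r)).
by rewrite ff gg.
Qed.
HB.instance Definition _ n :=
  GRing.isZmodClosed.Build (Tot n -> G) (@Bpred n) (@Bpred_closed n).

Definition HN n : zmodType := subquot (@Zpred n) (@Bpred n).
End FullCohomology.

Section SmallComplex.
(* used with u = p ^ nu, v = p ^ eta, t = p ^ (eta - nu), u' = p ^ (2 nu - eta) *)
Variables (u v t u' : nat) (G : zmodType).

Definition cyc_op (i j : 'Z_v) : 'Z_v := (1 - u%:R * i) * j.

Definition X2 : zmodType :=
  ({ffun 'Z_v * 'Z_v -> G} * {ffun 'Z_v -> G} * {ffun 'Z_v -> G})%type.

Definition is_cochain2 (x : X2) : Prop :=
  let: (F, al, be) := x in
  [/\ forall i j, F (i, j) = F (j, i), forall j, F (0, j) = 0,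
      al 0 = 0 & be 0 = 0].

Definition is_cocycle2 (x : X2) : Prop :=
  let: (F, al, be) := x in
  [/\ forall a b c, F (b, c) - F (a + b, c) + F (a, b + c) - F (a, b) = 0,
      forall i j, al i + al j - al (i + j)
        + F ((1 - u%:R) * i, (1 - u%:R) * j) - F (i, j) = 0,
      forall i j, be (i + j) = be i + be j,
      forall i, be ((1 - u%:R) * i) = be i /\ be i *+ u = 0 &
      forall i, - (\sum_(0 <= s < t) al ((1 - (s * u)%:R) * i)) - be i
        + (\sum_(1 <= s < t) be ((1 - (s * u)%:R) * i) *+ s) *+ u' = 0].

Definition X2_Z_pred : {pred X2} :=
  [pred x : X2 | `[< is_cochain2 x /\ is_cocycle2 x >]].

Definition X2_d (th : {ffun 'Z_v -> G}) : X2 :=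
  ([ffun ij => th (ij.1 + ij.2) - th ij.1 - th ij.2],
   [ffun i => th ((1 - u%:R) * i) - th i], 0).

Definition X2_B_pred : {pred X2} :=
  [pred x : X2 | `[< exists th : {ffun 'Z_v -> G}, th 0 = 0 /\ x = X2_d th >]].

Lemma X2_Z_closed : zmod_closed X2_Z_pred.
Proof.
split=> [|[[F al] be] [[F' al'] be']].
  apply/asboolP; split; split=> *; rewrite ?big1 => *;
    by rewrite ?ffunE /= ?mul0rn ?oppr0 ?subr0 ?addr0 ?ffunE ?mul0rn.
move=> /asboolP[[Fs F0 a0 b0] [FZ aZ bA bZ abZ]].
move=> /asboolP[[Fs' F0' a0' b0'] [FZ' aZ' bA' bZ' abZ']].
apply/asboolP; split; [split=> [i j|j||] | split=> [a b c|i j|i j|i|i]];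
  rewrite !ffunE /=.
- by rewrite Fs Fs'.
- by rewrite F0 F0' subrr.
- by rewrite a0 a0' subrr.
- by rewrite b0 b0' subrr.
- by rewrite subB subD subB FZ FZ' subrr.
- by rewrite (subD (al i)) (subB (al i + _)) subD subB aZ aZ' subrr.
- by rewrite bA bA' subD.
- by case: (bZ i) (bZ' i) => -> bu [-> bu']; rewrite mulrnBl bu bu' subrr.
under eq_bigr do rewrite !ffunE /=.
under [X in _ + X *+ _]eq_bigr do rewrite !ffunE /= mulrnBl.
by rewrite !sumrB mulrnBl [- (\sum_(0 <= s < t) al _ - _)]opprD subB subD abZ abZ' subrr.
Qed.
HB.instance Definition _ := GRing.isZmodClosed.Build X2 X2_Z_pred X2_Z_closed.

Lemma X2_B_closed : zmod_closed X2_B_pred.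
Proof.
have E (x y : X2) : x.1.1 = y.1.1 -> x.1.2 = y.1.2 -> x.2 = y.2 -> x = y.
  by case: x y => [[? ?] ?] [[? ?] ?] /= -> -> ->.
split=> [|x y /asboolP[th [th0 ->]] /asboolP[th' [th0' ->]]]; apply/asboolP.
  exists 0; split; first by rewrite ffunE.
  by apply: E => //; apply/ffunP=> i; rewrite !ffunE /= !subrr.
exists (th - th'); split; first by rewrite !ffunE /= th0 th0' subrr.
apply: E; last by rewrite /= subrr.
- rewrite /=; apply/ffunP=> i; rewrite !ffunE /=.
  by rewrite (subB _ _ (th i.1)) (subB _ _ (th i.2)).
- rewrite /=; apply/ffunP=> i; rewrite !ffunE /=.
  by rewrite (subB _ _ (th i)).
Qed.
HB.instance Definition _ := GRing.isZmodClosed.Build X2 X2_B_pred X2_B_closed.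

Definition X2_Z : zmodClosed X2 := X2_Z_pred.
Definition X2_B : zmodClosed X2 := X2_B_pred.

Definition H2X : zmodType := subquot X2_Z X2_B.

Definition f1 (ga : G) : {ffun 'Z_v * 'Z_v -> G} :=
  [ffun ij : 'Z_v * 'Z_v => let i : nat := ij.1 in let j : nat := ij.2 in
     if (i == 1%N) && (j == 1%N) then ga
     else if [&& 2 <= i, 2 <= j & i + j <= v + 1]%N then - ga else 0].

(* the pairs (k, l) used to write r = k t + l for 2 <= r < v; each such r has    *)
(* exactly one admissible decomposition                                          *)
Definition admissible (k l : nat) : bool :=
  if v == (u ^ 2)%N then
    [|| (k == 0) && (2 <= l <= t),
        (k == 1) && (1 <= l <= t + 2)
      | (2 <= k < t - 1) && (k < l <= t + k + 1)]%N
  else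
    [|| (k == 0) && (2 <= l <= t),
        (1 <= k < u') && (1 <= l <= t),
        (k == u') && (1 <= l <= t + 1),
        (u' < k <= 2 * u' - 2) && (2 <= l <= t + 1),
        [exists h : 'I_t,
           [&& 2 <= h, k == h * u' - 1 & h <= l <= t + h]]
      | [exists h : 'I_t,
           [&& 2 <= h, h * u' <= k <= h.+1 * u' - 2 & h < l <= t + h]]]%N.

Definition quot_of (r : nat) : nat :=
  if [pick k : 'I_r.+1 | (k * t <= r)%N && admissible k (r - k * t)] is Some k
  then k else 0%N.

Definition family (ga1 ga : G) : {ffun 'Z_v -> G} :=
  [ffun i : 'Z_v => let r : nat := i in
     if r == 0%N then 0
     else if r == 1%N then ga1
     else ga1 *+ r - ga *+ (quot_of r).+1].

Definition zco (ga1 ga : G) : X2 :=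
  (f1 ga, family ga1 ga, [ffun i : 'Z_v => - ((ga1 *+ t - ga) *+ i)]).
End SmallComplex.

Arguments X2_Z u v t u' G : clear implicits.
Arguments X2_B u v G : clear implicits.
Arguments H2X u v t u' G : clear implicits.
Arguments zco u v t u' G : clear implicits.

(* Main.v *)
(* A cocycle (F, alpha, beta) of the small complex is pulled back to the          *)
(* integers: P(n) = F(1, 0) + ... + F(1, n - 1) satisfies P(n + v) = P(n) + ga    *)
(* and F(i, j) = P(i + j) - P(i) - P(j), whereas alpha(n) - P((1 - u) n) + P(n)   *)
(* is additive in n, hence n (ga1 - ga) with v ga1 = u ga.  The pair (ga1, ga)    *)
(* determines the cocycle up to a coboundary; beta is a function of alpha, for    *)
(* w = u' t (t - 1) / 2 satisfies (1 - w) (1 + w) = 1 modulo u, and the closed    *)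
(* form of the family (ga_r) records the values of the potential P attached to    *)
(* f_1(ga).                                                                       *)
(*                                                                                *)
(* For the full complex, a 2-cocycle is a pair (F, A) with                        *)
(* A(a + b; c) = A(a; c) + A(a . b; a . c).  Since sigma(n) = n + u n (n - 1) / 2 *)
(* permutes Z/v and acts as 1 - n u, A(sigma(n); x) is the sum of alpha = A(1; _) *)
(* along the first n points of the orbit of x: A is determined by alpha, and it   *)
(* exists precisely when (F, alpha) extends to a cocycle of the small complex.    *)

(* Small complex. A symmetric 2-cocycle [F] on Z/v describes an abelian extension, which splits over
   the free group Z, so [F] has a potential [P] on the integers. Its quasi-period ga and the slope
   ga1 - ga of the linear function left over from alpha satisfy a single relation, v ga1 = u ga
   ([cocycle_potential]). [P] is unique up to adding n c, which moves (ga1, ga) by (u c, v c). Two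
   cocycles with equal pairs have potentials whose difference is v-periodic, hence differ by a
   coboundary ([cocycle_decomp], [zco_B]). With d = t ga1 - ga the relation reads u d = 0, because v
   = u t, and (u c, v c) becomes (u c, 0); this gives G/uG + G_u ([small_complex_cohomology]). The
   component beta adds no freedom: its defining equation can be solved because 1 - w is invertible
   modulo u ([cocycle_beta], [potential_in_Z]).

   Explicit cocycles. The potential of f_1(ga) is a step function ([f1_pot]), so alpha is governed
   by integer parts: the tabulated k is the floor of (u - 1) r / v, raised by one at r = u + 1
   ([quot_ofE], [family_pot]).

   Full complex. Its 2-cocycles are pairs (F, A). The action of 1 generates everything: the points
   sigma(n) exhaust Z/v ([sigma_surj]), and A(sigma(n); x) is an orbit sum of alpha = A(1; _)
   ([val_act_sigma]). Restricting to (F, alpha) and adding the forced beta gives the isomorphism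
   ([restr_cochain_in_Z], [restr_cochain_B], [restr_cochain_surj]). *)
Require Import Defs.
From HB Require Import structures.
From mathcomp Require Import all_boot all_fingroup all_algebra.
From mathcomp Require Import boolp classical_sets functions.
From mathcomp Require Import zify ring.

Set Implicit Arguments.
Unset Strict Implicit.
Unset Printing Implicit Defensive.

Import GRing.Theory.
Local Open Scope ring_scope.

(* The square-zero extension of the integers by G: identities in the abelian     *)
(* group G become identities in a commutative ring, within reach of [ring].      *)
Section SquareZero.
Variable G : zmodType.

Definition sqz : Type := (int * G)%type.
HB.instance Definition _ := GRing.Zmodule.on sqz.

Definition sqz_mul (x y : sqz) : sqz := (x.1 * y.1, y.2 *~ x.1 + x.2 *~ y.1).
Definition sqz_one : sqz := (1, 0).

Lemma sqz_mulA : associative sqz_mul.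
Proof.
move=> [a x] [b y] [c z]; congr (_, _) => /=; first by rewrite mulrA.
by rewrite !mulrzDl !mulrzA addrA -!mulrzA [c * a]mulrC [b * a]mulrC.
Qed.

Lemma sqz_mulC : commutative sqz_mul.
Proof. by move=> [a x] [b y]; congr (_, _) => /=; [rewrite mulrC|rewrite addrC]. Qed.

Lemma sqz_mul1 : left_id sqz_one sqz_mul.
Proof. by move=> [a x]; congr (_, _) => /=; rewrite ?mul1r // mul0rz addr0. Qed.

Lemma sqz_mulDl : left_distributive sqz_mul +%R.
Proof.
move=> [a x] [b y] [c z]; congr (_, _) => /=; first by rewrite mulrDl.
by rewrite mulrzDl mulrzDr addrACA.
Qed.

Lemma sqz_one_neq0 : sqz_one != 0.
Proof. by []. Qed.

HB.instance Definition _ := GRing.Zmodule_isComNzRing.Build sqz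
  sqz_mulA sqz_mulC sqz_mul1 sqz_mulDl sqz_one_neq0.

Definition sqz_emb (x : G) : sqz := (0, x).

Lemma sqz_emb_additive : zmod_morphism sqz_emb.
Proof. by move=> x y; congr (_, _); rewrite subr0. Qed.
HB.instance Definition _ :=
  GRing.isZmodMorphism.Build G sqz sqz_emb sqz_emb_additive.

Lemma sqz_emb_inj : injective sqz_emb.
Proof. by move=> x y []. Qed.
End SquareZero.

Ltac zmod := apply: sqz_emb_inj; ring.

(** * Quotients of abelian groups and the first isomorphism theorem for subquotients *)

Section AdditiveQuotient.
Local Open Scope quotient_scope.

Lemma mk_additive (V W : zmodType) (f : V -> W) :
  zmod_morphism f -> exists F : {additive V -> W}, F =1 f.
Proof.
move=> fB; pose F := HB.pack_for {additive V -> W} f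
  (GRing.isZmodMorphism.Build V W f fB).
by exists F.
Qed.

Lemma mk_zmodClosed (V : zmodType) (S : {pred V}) :
  zmod_closed S -> exists I : zmodClosed V, I =i S.
Proof.
move=> Sc; pose I := HB.pack_for (zmodClosed V) S (GRing.isZmodClosed.Build V S Sc).
by exists I.
Qed.

Lemma inj_surj_bij (V W : Type) (f : V -> W) :
  injective f -> (forall w, exists x, f x = w) -> bijective f.
Proof.
move=> fI /choice[g gK]; exists g => // x; apply: fI; exact: gK.
Qed.

Section Quot.
Variables (V : zmodType) (I : zmodClosed V).
Local Notation Q := (Quotient.quot I).

Lemma quot_piB (x y : V) : \pi_Q (x - y) = \pi_Q x - \pi_Q y.
Proof. by rewrite !piE. Qed.

Lemma quot_pi_eq (x y : V) : (\pi_Q x == \pi_Q y) = (x - y \in I).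
Proof. by rewrite Quotient.idealrBE. Qed.

Lemma quot_pi0 (x : V) : (\pi_Q x == 0) = (x \in I).
Proof.
rewrite -[x in RHS]subr0 -quot_pi_eq.
by have := quot_piB 0 0; rewrite !subrr => ->.
Qed.
End Quot.

Section FirstIsomorphism.
Variables (V : zmodType) (Z B : zmodClosed V) (W : zmodType) (f : subgp Z -> W).
Hypothesis fB : zmod_morphism f.
Hypothesis f_ker : forall x, (f x == 0) = (val x \in B).
Hypothesis f_surj : forall w, exists x, f x = w.

Lemma subquot_isog : exists F : {additive subquot Z B -> W},
  bijective F /\ forall x, F (subquot_class B x) = f x.
Proof.
have f_eq x y : (f x == f y) = (val x - val y \in B).
  by rewrite -subr_eq0 -fB f_ker raddfB.
pose F (c : subquot Z B) := f (generic_quotient.repr c).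
have piE' x : F (subquot_class B x) = f x.
  apply/eqP; rewrite f_eq.
  have : \pi_(subquot Z B) (generic_quotient.repr (subquot_class B x)) == \pi_(subquot Z B) x.
    by rewrite reprK.
  by rewrite quot_pi_eq inE raddfB.
have FB : zmod_morphism F.
  move=> a b; rewrite -[a]reprK -[b]reprK.
  have -> : \pi_(subquot Z B) (generic_quotient.repr a) -
      \pi_(subquot Z B) (generic_quotient.repr b) =
    subquot_class B (generic_quotient.repr a - generic_quotient.repr b) by rewrite -quot_piB.
  by rewrite piE' fB !(piE' (generic_quotient.repr _)).
have [F' F'E] := mk_additive FB.
exists F'; split=> [|x]; last by rewrite F'E piE'.
apply: inj_surj_bij => [a b|w].
  rewrite !F'E /F => /eqP; rewrite f_eq => abB; rewrite -[a]reprK -[b]reprK.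
  by apply/eqP; rewrite quot_pi_eq inE raddfB.
by have [x <-] := f_surj w; exists (subquot_class B x); rewrite F'E piE'.
Qed.
End FirstIsomorphism.

Lemma subquot_class_surj (V : zmodType) (Z B : zmodClosed V) (c : subquot Z B) :
  exists x, subquot_class B x = c.
Proof. by exists (generic_quotient.repr c); rewrite /subquot_class reprK. Qed.

Lemma subquot_class_eq0 (V : zmodType) (Z B : zmodClosed V) (x : subgp Z) :
  (subquot_class B x == 0) = (val x \in B).
Proof. exact: quot_pi0. Qed.

Lemma subquot_classB (V : zmodType) (Z B : zmodClosed V) :
  zmod_morphism (@subquot_class V Z B).
Proof. exact: quot_piB. Qed.

Lemma quo_multiples_class_eq0 (V : zmodType) r (x : V) :
  (quo_multiples_class r x == 0) = `[< exists y, x = y *+ r >].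
Proof. exact: quot_pi0. Qed.

Lemma quo_multiples_classB (V : zmodType) r :
  zmod_morphism (@quo_multiples_class V r).
Proof. exact: quot_piB. Qed.

Lemma quo_multiples_class_surj (V : zmodType) r (c : quo_multiples V r) :
  exists x, quo_multiples_class r x = c.
Proof. by exists (generic_quotient.repr c); rewrite /quo_multiples_class reprK. Qed.
End AdditiveQuotient.

(** * Low-degree cochains of the full complex, described by their values on generators *)

Section FullComplexTheory.
Variables (C : finZmodType) (G : zmodType).

Section Pairing.
Variable n : nat.
Implicit Types (phi : {ffun 'I_n -> C} -> G) (c : tens_pow C n).

(** The linear extension of [phi] from C^n to Z[C^n]. Homomorphisms on the quotient [Chat n r] are
    handled as functions whose pairing kills [tens_rel]. *)
Definition pairing phi c : G := \sum_x phi x *~ c x.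

Lemma pairingB phi : zmod_morphism (pairing phi).
Proof.
by move=> c d; rewrite /pairing -sumrB; apply: eq_bigr => x _; rewrite !ffunE mulrzBr.
Qed.
HB.instance Definition _ phi :=
  GRing.isZmodMorphism.Build (tens_pow C n) G (pairing phi) (pairingB phi).

Lemma pairing_basis phi x : pairing phi (basis x) = phi x.
Proof.
rewrite /pairing (bigD1 x) //= ffunE eqxx mulr1z big1 ?addr0 // => y yx.
by rewrite ffunE (negbTE yx) mulr0z.
Qed.

Lemma basis_sum c : c = \sum_x basis x *~ c x.
Proof.
apply/ffunP => y; rewrite sum_ffunE (bigD1 y) //= big1 => [|x yx].
  by rewrite addr0 ffunMzE ffunE eqxx mulr1n intz.
by rewrite ffunMzE ffunE eq_sym (negbTE yx) mul0rz.
Qed.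
End Pairing.

Section Generators.
Variable n : nat.

Lemma Chat_classB r : zmod_morphism (@Chat_class C n r).
Proof. exact: quot_piB. Qed.
HB.instance Definition _ r := GRing.isZmodMorphism.Build (tens_pow C n) (Chat C n r)
  (@Chat_class C n r) (@Chat_classB r).

Lemma Chat_class_rel r (c : tens_pow C n) : tens_rel r c -> Chat_class r c = 0.
Proof.
move=> rc; apply/eqP; rewrite /Chat_class quot_pi0; apply/asboolP => P PS.
exact: PS.
Qed.

Lemma dsum_sumE (J : Type) (s : seq J) (F : J -> Tot C n) q :
  (\sum_(j <- s) F j) q = \sum_(j <- s) (F j q : Chat C n q).
Proof. by elim/big_rec2: _ => // j y z _ <-. Qed.

Lemma dsum_mulzE (y : Tot C n) k q : (y *~ k) q = (y q : Chat C n q) *~ k.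
Proof.
have N m : (y *+ m) q = (y q : Chat C n q) *+ m.
  by elim: m => [|m IH] //; rewrite !mulrS -IH.
by case: k => m; [exact: N|exact: (congr1 -%R (N m.+1))].
Qed.

Lemma Tot_sum (c : 'I_n -> tens_pow C n) :
  (fun q => Chat_class q (c q)) = \sum_q \sum_x generator q x *~ c q x :> Tot C n.
Proof.
apply: functional_extensionality_dep => q.
rewrite dsum_sumE (bigD1 q) //= [X in _ + X]big1 ?addr0 => [|r rq].
  rewrite dsum_sumE {1}[c q]basis_sum raddf_sum; apply: eq_bigr => x _.
  by rewrite raddfMz dsum_mulzE /generator eqxx.
rewrite dsum_sumE; apply: big1 => x _.
rewrite dsum_mulzE /generator eq_sym (negbTE rq); apply: mul0rz.
Qed.

Variable f : Tot C n -> G.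
Hypothesis fH : f \in @Hom_pred C G n.

Lemma Hom_additive : exists F : {additive Tot C n -> G}, F =1 f.
Proof. by apply: mk_additive; exact/asboolP. Qed.

Lemma Hom_pairing (c : 'I_n -> tens_pow C n) :
  f (fun q => Chat_class q (c q)) = \sum_q pairing (fun x => f (generator q x)) (c q).
Proof.
have [F FE] := Hom_additive; rewrite Tot_sum -FE raddf_sum.
apply: eq_bigr => q _; rewrite raddf_sum; apply: eq_bigr => x _.
by rewrite raddfMz FE.
Qed.

Lemma Hom0 : f 0 = 0.
Proof. by have [F FE] := Hom_additive; rewrite -FE raddf0. Qed.

Lemma pure_delta (x : {ffun 'I_n -> C}) :
  pure (fun i => [ffun a => (a == x i)%:R]) = basis x.
Proof.
apply/ffunP => y; rewrite !ffunE; have [->|/eqP yx] := eqVneq y x.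
  by rewrite big1 // => i _; rewrite ffunE eqxx.
have [i yxi] : exists i, y i != x i.
  by apply/existsP; apply: contra_notT yx => /existsPn H; apply/ffunP => i;
    apply/eqP; rewrite -[_ == _]negbK H.
by rewrite (bigD1 i) //= ffunE (negbTE yxi) mul0r.
Qed.

(** The entry 0 : C stands for the identity of the group ring, so this basis tensor is itself a
    normalization relation. *)
Lemma generator_normalized q (x : {ffun 'I_n -> C}) i : x i = 0 -> f (generator q x) = 0.
Proof.
move=> xi; rewrite -[RHS]Hom0; congr f.
apply: functional_extensionality_dep => r; rewrite /generator.
case: eqP => // _; apply: Chat_class_rel; left.
exists (fun i => [ffun a => (a == x i)%:R]), i, 1; rewrite pure_delta; split=> //.
by apply/ffunP => a; rewrite !ffunE xi mulr1.
Qed.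
End Generators.

(** The kernel of a pairing is a subgroup; once it contains the relations it contains what they
    generate. Each [phi q] thus descends to its summand, and the descended maps are added up. *)
Lemma Hom_exists n (phi : 'I_n -> {ffun 'I_n -> C} -> G) :
  (forall (q : 'I_n) c, tens_rel q c -> pairing (phi q) c = 0) ->
  exists2 f : Tot C n -> G, f \in @Hom_pred C G n &
    forall q x, f (generator q x) = phi q x.
Proof.
move=> H.
have H' (q : 'I_n) c : c \in gen (@tens_rel C n q) -> pairing (phi q) c = 0.
  pose S : {pred tens_pow C n} := [pred c | pairing (phi q) c == 0].
  have Sc : zmod_closed S.
    by split=> [|a b]; rewrite !inE ?raddf0 // => /eqP a0 /eqP b0; rewrite pairingB a0 b0 subrr.
  have [P PE] := mk_zmodClosed Sc; move=> /asboolP/(_ P) cP.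
  by apply/eqP; have := cP _; rewrite PE; apply => s /H E; rewrite PE inE E.
pose ev (q : 'I_n) (k : Chat C n q) := pairing (phi q) (generic_quotient.repr k).
have evE (q : 'I_n) c : ev q (Chat_class q c) = pairing (phi q) c.
  apply/eqP; rewrite -subr_eq0 -raddfB; apply/eqP/H'.
  by rewrite -quot_pi_eq reprK.
have evB (q : 'I_n) : zmod_morphism (ev q).
  move=> a b; rewrite -[a]reprK -[b]reprK -quot_piB.
  by rewrite -!/(Chat_class _ _) !evE raddfB.
exists (fun y => \sum_q ev q (y q)).
  apply/asboolP => y z; rewrite -sumrB; apply: eq_bigr => q _.
  exact: evB.
move=> q x; rewrite (bigD1 q) //= /generator eqxx evE pairing_basis.
rewrite big1 ?addr0 // => r rq; rewrite (negbTE rq).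
by have := evB r 0 0; rewrite !subrr.
Qed.

Lemma pairing_normalized n (phi : {ffun 'I_n -> C} -> G) (d : 'I_n -> {ffun C -> int}) i k :
  (forall (x : {ffun 'I_n -> C}) j, x j = 0 -> phi x = 0) -> d i = [ffun a => (a == 0)%:R * k] ->
  pairing phi (pure d) = 0.
Proof.
move=> phi0 di; apply: big1 => x _; rewrite ffunE (bigD1 i) //= di ffunE.
by have [/phi0 ->|_] := eqVneq (x i) 0; rewrite ?mul0rz // !mul0r mulr0z.
Qed.

Lemma Hom1_exists (th : C -> G) : th 0 = 0 ->
  exists2 f : Tot C 1 -> G, f \in @Hom_pred C G 1 &
    forall q x, f (generator q x) = th (x ord0).
Proof.
move=> th0; apply: (@Hom_exists 1 (fun _ x => th (x ord0))) => q c.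
(* In degree 1 there are no shuffle relations: [1 <= l] and [q + l < 1] are incompatible. *)
case=> [[d [i [k [di ->]]]]|[d [l [l1 ll _]]]]; last by lia.
by apply: pairing_normalized di => x j; rewrite (ord1 j) => ->.
Qed.

Lemma ord2P (i : 'I_2) : i = ord0 \/ i = ord_max.
Proof. by case: i => [[|[|]]] // p; [left|right]; apply: val_inj. Qed.

Definition pair_ffun (a b : C) : {ffun 'I_2 -> C} := [ffun i : 'I_2 => if i == ord0 then a else b].

Lemma pair_ffunE (x : {ffun 'I_2 -> C}) : x = pair_ffun (x ord0) (x ord_max).
Proof.
apply/ffunP => i; rewrite ffunE; case: eqP => [->//|/eqP i0]; congr (x _).
by apply: val_inj; case: i i0 => [[|[|]]].
Qed.

Definition swap2 : 'S_2 := tperm ord0 ord_max.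

Lemma sum_S2 (V : zmodType) (psi : 'S_2 -> V) : \sum_s psi s = psi 1%g + psi swap2.
Proof.
have ne : swap2 != 1%g.
  apply/eqP => /permP/(_ ord0); rewrite tpermL perm1 => /(congr1 val); by [].
rewrite (bigD1 1%g) //= (bigD1 swap2) //= big1 ?addr0 // => s /andP[s1 s2].
case: (ord2P (s ord0)) => E0.
  case/eqP: s1; apply/permP => i; rewrite perm1; case: (ord2P i) => -> //.
  by case: (ord2P (s ord_max)) => // E; have := perm_inj (etrans E (esym E0)).
case/eqP: s2; apply/permP => i; case: (ord2P i) => ->; rewrite ?tpermL ?tpermR //.
by case: (ord2P (s ord_max)) => // E; have := perm_inj (etrans E (esym E0)).
Qed.

(** Both permutations of two letters are shuffles and the swap is odd, so in degree 2 the shuffle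
    relation expresses symmetry. *)
Lemma shuffle2_sum (d : 'I_2 -> {ffun C -> int}) :
  \sum_(s : 'S_2 | is_shuffle 0 1 s) pure (fun i => d ((s^-1)%g i)) *~ (-1) ^+ s =
  pure d - pure (fun i => d (swap2 i)).
Proof.
rewrite (eq_bigl predT) => [|s].
  rewrite sum_S2 odd_perm1 odd_tperm /= expr0 expr1 mulr1z mulrNz mulr1z.
  by rewrite invg1 tpermV; congr (pure _ - _); apply: funext => i; rewrite perm1.
apply/andP; split; first by apply/forallP.
apply/forallP => i; apply/forallP => j; apply/implyP.
by case: i j => [[|[|i]] pi] [[|[|j]] pj].
Qed.

Lemma Hom2_exists (F A : C -> C -> G) :
  (forall a, F 0 a = 0) -> (forall a b, F a b = F b a) ->
  (forall a, A 0 a = 0) -> (forall a, A a 0 = 0) ->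
  exists2 f : Tot C 2 -> G, f \in @Hom_pred C G 2 &
    (forall a b, f (generator ord0 (pair_ffun a b)) = F a b) /\
    (forall a b, f (generator ord_max (pair_ffun a b)) = A a b).
Proof.
move=> F0 Fs A0 A0'.
pose phi (q : 'I_2) (x : {ffun 'I_2 -> C}) :=
  if q == ord0 then F (x ord0) (x ord_max) else A (x ord0) (x ord_max).
have phi0 q (x : {ffun 'I_2 -> C}) i : x i = 0 -> phi q x = 0.
  have [->|->] := ord2P i.
  - by rewrite /phi => ->; case: ifP.
  - by rewrite /phi => ->; case: ifP => // _; rewrite Fs.
have [q c|f fH fE] := @Hom_exists 2 phi.
  case=> [[d [i [k [di ->]]]]|[d [l [l1 ll ->]]]].
    by apply: pairing_normalized di => x j; exact: phi0.
  have [q0 lE] : q = ord0 /\ l = 1%N.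
    by case: q ll => [[|[|]]] // p /=; split; try apply: val_inj => /=; lia.
  rewrite q0 lE shuffle2_sum pairingB; apply/eqP; rewrite subr_eq0; apply/eqP.
  pose h (x : {ffun 'I_2 -> C}) := [ffun i => x (swap2 i)].
  have hK : involutive h by move=> x; apply/ffunP => i; rewrite !ffunE tpermK.
  rewrite /pairing [LHS](reindex_inj (inv_inj hK)) /=; apply: eq_bigr => x _.
  congr (_ *~ _).
    by rewrite /phi /= !ffunE tpermL tpermR Fs.
  rewrite !ffunE [RHS](reindex_inj (@perm_inj _ swap2)) /=; apply: eq_bigr => i _.
  by rewrite ffunE tpermK.
by exists f => //; split=> a b; rewrite fE /phi /= !ffunE.
Qed.

Lemma generator_sym (f : Tot C 2 -> G) a b : f \in @Hom_pred C G 2 ->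
  f (generator ord0 (pair_ffun a b)) = f (generator ord0 (pair_ffun b a)).
Proof.
move=> fH; have [F FE] := Hom_additive fH; rewrite -!FE.
apply/eqP; rewrite -subr_eq0 -raddfB FE; apply/eqP; rewrite -[RHS](Hom0 fH); congr f.
apply: functional_extensionality_dep => q.
change ((generator ord0 (pair_ffun a b) : Tot C 2) q -
  (generator ord0 (pair_ffun b a) : Tot C 2) q = 0).
rewrite /generator; case: eqP => [->|_]; last by rewrite subrr.
rewrite -raddfB; apply: Chat_class_rel; right.
exists (fun i => [ffun c => (c == pair_ffun a b i)%:R]), 1%N; split=> //.
refine (etrans _ (esym (shuffle2_sum _))); congr (_ - _).
  exact/esym/pure_delta.
rewrite -pure_delta; congr pure.
apply: funext => i; congr finfun; apply: funext => c; rewrite !ffunE.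
case: i => [[|[|]]] // p.
  by rewrite (_ : Ordinal p = ord0) ?tpermL //; apply: val_inj.
by rewrite (_ : Ordinal p = ord_max) ?tpermR //; apply: val_inj.
Qed.

Variable dot : C -> C -> C.

Lemma pairing_bd_h n phi (x : {ffun 'I_n.+1 -> C}) r :
  pairing phi (bd_h dot x r) = phi (act_first dot x) +
    \sum_(1 <= j < r) phi (Defs.merge x j) *~ (-1) ^+ j + phi (omit x r) *~ (-1) ^+ r.
Proof.
rewrite /bd_h !raddfD raddf_sum raddfMz; congr (_ + _ + _ *~ _); try exact: pairing_basis.
by apply: eq_bigr => j _; rewrite raddfMz; congr (_ *~ _); exact: pairing_basis.
Qed.

Lemma pairing_bd_v n phi (x : {ffun 'I_n.+1 -> C}) r :
  pairing phi (bd_v x r) = phi (omit x r.+1) *~ (-1) ^+ r.+1 +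
    \sum_(r.+1 <= j < n.+1) phi (Defs.merge x j) *~ (-1) ^+ j.+1 +
    phi (omit x n.+1) *~ (-1) ^+ n.+2.
Proof.
rewrite /bd_v !raddfD raddf_sum !raddfMz; congr (_ *~ _ + _ + _ *~ _); try exact: pairing_basis.
by apply: eq_bigr => j _; rewrite raddfMz; congr (_ *~ _); exact: pairing_basis.
Qed.

Lemma Hom_boundary n (f : Tot C n -> G) (x : {ffun 'I_n.+1 -> C}) (r : 'I_n.+1) :
  f \in @Hom_pred C G n ->
  f (boundary dot x r) = \sum_(q < n)
    ((if q.+1 == r :> nat then pairing (fun y => f (generator q y)) (bd_h dot x r) else 0) +
     (if q == r :> nat then pairing (fun y => f (generator q y)) (bd_v x r) else 0)).
Proof.
move=> fH; pose c (q : 'I_n) := (if q.+1 == r :> nat then bd_h dot x r else 0) +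
  (if q == r :> nat then bd_v x r else 0).
have -> : boundary dot x r = fun q => Chat_class q (c q).
  apply: functional_extensionality_dep => q; rewrite /boundary /c.
  by case: eqP => _; case: eqP => _; rewrite ?addr0 ?add0r // ?raddfD // [RHS]raddf0.
rewrite Hom_pairing //; apply: eq_bigr => q _; rewrite /c raddfD.
by congr (_ + _); case: ifP => // _; exact: raddf0.
Qed.

Definition single_ffun (a : C) : {ffun 'I_1 -> C} := [ffun=> a].
Definition triple_ffun (a b c : C) : {ffun 'I_3 -> C} :=
  [ffun i : 'I_3 => if i == 0%N :> nat then a else if i == 1%N :> nat then b else c].

Lemma triple_ffunE (x : {ffun 'I_3 -> C}) :
  x = triple_ffun (x ord0) (x (inord 1)) (x (inord 2)).
Proof.
by apply/ffunP => i; rewrite ffunE; case: i => [[|[|[|]]]] // p /=; congr (x _);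
  apply: val_inj; rewrite /= ?inordK.
Qed.

Lemma single_ffunE (x : {ffun 'I_1 -> C}) : x = single_ffun (x ord0).
Proof. by apply/ffunP => i; rewrite ffunE (ord1 i). Qed.

Section Faces2.
Variables a b : C.
Local Notation x := (pair_ffun a b).

Let face1 (y : {ffun 'I_1 -> C}) c : y ord0 = c -> y = single_ffun c.
Proof. by move=> <-; exact: single_ffunE. Qed.

Lemma act_first_pair : act_first dot x = single_ffun (dot a b).
Proof. by apply: face1; rewrite !ffunE. Qed.
Lemma merge_pair : Defs.merge x 1 = single_ffun (a + b).
Proof. by apply: face1; rewrite !ffunE /= -!val_eqE /= !inordK. Qed.
Lemma omit1_pair : omit x 1 = single_ffun b.
Proof. by apply: face1; rewrite !ffunE /= -!val_eqE /= !inordK. Qed.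
Lemma omit2_pair : omit x 2 = single_ffun a.
Proof. by apply: face1; rewrite !ffunE /= -!val_eqE /= !inordK. Qed.
End Faces2.

Section Faces3.
Variables a b c : C.
Local Notation x := (triple_ffun a b c).

Let face2 (y : {ffun 'I_2 -> C}) d e : y ord0 = d -> y ord_max = e -> y = pair_ffun d e.
Proof. by move=> <- <-; exact: pair_ffunE. Qed.

Lemma act_first_triple : act_first dot x = pair_ffun (dot a b) (dot a c).
Proof. by apply: face2; rewrite !ffunE. Qed.
Lemma merge1_triple : Defs.merge x 1 = pair_ffun (a + b) c.
Proof. by apply: face2; rewrite !ffunE /= !inordK. Qed.
Lemma merge2_triple : Defs.merge x 2 = pair_ffun a (b + c).
Proof. by apply: face2; rewrite !ffunE /= !inordK. Qed.
Lemma omit1_triple : omit x 1 = pair_ffun b c.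
Proof. by apply: face2; rewrite !ffunE /= !inordK. Qed.
Lemma omit2_triple : omit x 2 = pair_ffun a c.
Proof. by apply: face2; rewrite !ffunE /= !inordK. Qed.
Lemma omit3_triple : omit x 3 = pair_ffun a b.
Proof. by apply: face2; rewrite !ffunE /= !inordK. Qed.
End Faces3.

Lemma lift00 : lift ord0 ord0 = ord_max :> 'I_2.
Proof. exact: val_inj. Qed.

Section Cochains2.
Variable f : Tot C 2 -> G.
Hypothesis fH : f \in @Hom_pred C G 2.

Definition val_sym a b := f (generator ord0 (pair_ffun a b)).
Definition val_act a b := f (generator ord_max (pair_ffun a b)).

Lemma val_sym0 a : val_sym 0 a = 0.
Proof. by apply: (@generator_normalized _ _ fH _ _ ord0); rewrite ffunE. Qed.

Lemma val_symC a b : val_sym a b = val_sym b a.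
Proof. exact: generator_sym. Qed.

Lemma val_act0l a : val_act 0 a = 0.
Proof. by apply: (@generator_normalized _ _ fH _ _ ord0); rewrite ffunE. Qed.

Lemma val_act0r a : val_act a 0 = 0.
Proof. by apply: (@generator_normalized _ _ fH _ _ ord_max); rewrite ffunE. Qed.

Lemma boundary0_val a b c : f (boundary dot (triple_ffun a b c) ord0) =
  - val_sym b c + val_sym (a + b) c - val_sym a (b + c) + val_sym a b.
Proof.
rewrite Hom_boundary // !big_ord_recl big_ord0 /= !add0r !addr0 pairing_bd_v.
rewrite /index_iota /= ?big_cons ?big_nil /= omit1_triple merge1_triple merge2_triple omit3_triple.
by rewrite -!/(val_sym _ _); zmod.
Qed.

Lemma boundary1_val a b c (r : 'I_3) : r = 1%N :> nat ->
  f (boundary dot (triple_ffun a b c) r) =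
  val_sym (dot a b) (dot a c) - val_sym b c + val_act a c - val_act a (b + c) + val_act a b.
Proof.
move=> r1; rewrite Hom_boundary // !big_ord_recl big_ord0 /= r1 /= lift00 !add0r !addr0.
rewrite pairing_bd_v pairing_bd_h.
rewrite /index_iota /= ?big_cons ?big_nil /= act_first_triple omit1_triple omit2_triple
  merge2_triple omit3_triple.
by rewrite -!/(val_sym _ _) -!/(val_act _ _); zmod.
Qed.

Lemma boundary2_val a b c (r : 'I_3) : r = 2%N :> nat ->
  f (boundary dot (triple_ffun a b c) r) =
  val_act (dot a b) (dot a c) - val_act (a + b) c + val_act a c.
Proof.
move=> r1; rewrite Hom_boundary // !big_ord_recl big_ord0 /= r1 /= lift00 !add0r !addr0.
rewrite pairing_bd_h.
rewrite /index_iota /= ?big_cons ?big_nil /= act_first_triple omit2_triple merge1_triple.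
by rewrite -!/(val_act _ _); zmod.
Qed.

(** One identity for each type r = 0, 1, 2 of generator in degree 3: F is a group cocycle, A(a; _)
    trivialises the difference between F and its translate by a, and A is a crossed homomorphism in
    its first argument. *)
Lemma Zpred2P : (f \in @Zpred C dot G 2) <->
  [/\ forall a b c, - val_sym b c + val_sym (a + b) c - val_sym a (b + c) + val_sym a b = 0,
      forall a b c, val_sym (dot a b) (dot a c) - val_sym b c
        + val_act a c - val_act a (b + c) + val_act a b = 0 &
      forall a b c, val_act (dot a b) (dot a c) - val_act (a + b) c + val_act a c = 0].
Proof.
split=> [/andP[_ /asboolP cob]|[H0 H1 H2]].
  have cob' r x : f (boundary dot x r) = 0 by rewrite -cob.
  split=> a b c; first by rewrite -boundary0_val.
    by rewrite -(boundary1_val _ _ _ (r := inord 1)) ?inordK.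
  by rewrite -(boundary2_val _ _ _ (r := inord 2)) ?inordK.
apply/andP; split=> //; apply/asboolP => r x; rewrite [x]triple_ffunE.
apply: (etrans (y := 0)) => //; apply/esym.
have [r0|[r1|r2]] : (r = ord0 \/ r = 1%N :> nat \/ r = 2%N :> nat).
  by case: r => [[|[|[|]]]] // p; [left; apply: val_inj|right; left|right; right].
- by rewrite r0 boundary0_val.
- by rewrite boundary1_val.
- by rewrite boundary2_val.
Qed.

Lemma Bpred2P : (f \in @Bpred C dot G 2) <->
  exists th : C -> G, [/\ th 0 = 0, forall a b, val_sym a b = th (a + b) - th a - th b &
    forall a b, val_act a b = th (dot a b) - th b].
Proof.
have H1 (h : Tot C 1 -> G) (th : C -> G) : h \in @Hom_pred C G 1 ->
    (forall q y, h (generator q y) = th (y ord0)) -> forall a b,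
    h (boundary dot (pair_ffun a b) ord0) = th (a + b) - th a - th b /\
    h (boundary dot (pair_ffun a b) ord_max) = th (dot a b) - th b.
  move=> hH hE a b; split; rewrite Hom_boundary // big_ord_recl big_ord0 /= ?add0r ?addr0.
    rewrite pairing_bd_v /index_iota /= ?big_cons ?big_nil /= !hE omit1_pair omit2_pair merge_pair.
    by rewrite !ffunE; zmod.
  rewrite pairing_bd_h /index_iota /= ?big_nil !hE omit1_pair act_first_pair !ffunE; zmod.
split=> [/andP[_ /asboolP[h [hH cob]]]|[th [th0 sE aE]]].
  pose th a := h (generator ord0 (single_ffun a)).
  have hE q y : h (generator q y) = th (y ord0).
    by rewrite (ord1 q) [y]single_ffunE /th ffunE.
  exists th; split=> [|a b|a b].
  - by apply: (@generator_normalized _ _ hH _ _ ord0); rewrite ffunE.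
  - by rewrite /val_sym cob; exact: (H1 _ _ hH hE a b).1.
  - by rewrite /val_act cob; exact: (H1 _ _ hH hE a b).2.
have [h hH hE] := Hom1_exists th0.
apply/andP; split=> //; apply/asboolP; exists h; split=> // r x.
rewrite [x]pair_ffunE; have [E1 E2] := H1 _ _ hH hE (x ord0) (x ord_max).
have [->|->] := ord2P r.
- by rewrite E1; exact: sE.
- by rewrite E2; exact: aE.
Qed.
End Cochains2.
End FullComplexTheory.

(** * A floor formula for the tabulated index k *)

Section QuotOf.
Variables u v t u' : nat.
Hypotheses (t_gt1 : (1 < t)%N) (u_gt2 : (2 < u)%N).
Hypotheses (uE : u = (t * u')%N) (vE : v = (u * t)%N).

(** Since v = u t, (u - 1)(k t + l) = k v + ((u - 1) l - k t): the inequalities say that k is the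
    floor of (u - 1)(k t + l) / v. *)
Let in_range k l := (k * t <= (u - 1) * l < (k + u) * t)%N.

Let in_rangeE k l : in_range k l -> ((u - 1) * (k * t + l) %/ v)%N = k.
Proof.
move=> /andP[lo hi]; have v_gt0 : (0 < v)%N by rewrite vE; nia.
have -> : ((u - 1) * (k * t + l) = k * v + ((u - 1) * l - k * t))%N.
  by rewrite vE; nia.
rewrite divnMDl // divn_small ?addn0 //; rewrite vE; nia.
Qed.

Let in_range_div r : let k := ((u - 1) * r %/ v)%N in
  (k * t <= r)%N /\ in_range k (r - k * t).
Proof.
move=> k; have v_gt0 : (0 < v)%N by rewrite vE; nia.
have lo : (k * v <= (u - 1) * r)%N by apply: leq_divM.
have hi : ((u - 1) * r < (k + 1) * v)%N by rewrite addn1 ltn_ceil.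
have le : (k * t <= r)%N by rewrite vE in lo; nia.
split=> //; rewrite /in_range; rewrite vE in lo hi.
have -> : ((u - 1) * (r - k * t) = (u - 1) * r - (u - 1) * (k * t))%N.
  by rewrite mulnBr.
by apply/andP; split; nia.
Qed.

(** Both inequalities are monotone in l, so a row of the table is tested at its two ends only. *)
Let in_range_bounds k l lo hi : (lo <= l <= hi)%N ->
  (k * t + lo <= u * lo)%N -> (u * hi < (k + u) * t + hi)%N -> in_range k l.
Proof.
have uS : u = (u - 1 + 1)%N by lia.
move=> /andP[le_lo le_hi]; rewrite {1 2}uS !mulnDl !mul1n => klo khi.
have := leq_mul (leqnn (u - 1)) le_lo; have := leq_mul (leqnn (u - 1)) le_hi.
by rewrite /in_range; lia.
Qed.

(** The exception is r = u + 1, which the table writes with k = u', l = 1, whereas the floor there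
    is u' - 1. *)
Let admissible_sound k l : admissible u v t u' k l -> (k * t + l < v)%N ->
  if (k * t + l == u + 1)%N then k = u' else in_range k l.
Proof.
rewrite /admissible; case: eqP => vu.
  have tu : t = u by rewrite vE in vu; nia.
  have u'1 : u' = 1%N by nia.
  case/or3P; try case/andP.
  - move=> /eqP -> hl hv; have -> : ((0 * t + l) == u + 1)%N = false by lia.
    by apply: in_range_bounds hl _ _; rewrite tu; lia.
  - move=> /eqP -> hl hv; case: eqP => hne; first by lia.
    (* The value l = 1 of this row is the exceptional r, so the bounds start at 2. *)
    apply: (@in_range_bounds _ _ 2 (t + 2)); rewrite tu; lia.
  - move=> hk hl hv; have kt : (2 * t <= k * t)%N by rewrite leq_mul2r; lia.
    have -> : ((k * t + l) == u + 1)%N = false by lia.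
    by apply: in_range_bounds hl _ _; rewrite tu; lia.
have u'_gt1 : (1 < u')%N.
  case: u' uE => [|[|//]] uE'; first by lia.
  by case: vu; rewrite vE uE' muln1 mulnn.
have ltu : (t + t <= u)%N by rewrite uE addnn -muln2 leq_mul2l u'_gt1 orbT.
have kut m : (m <= k -> m * t <= k * t)%N by move=> km; rewrite leq_mul2r km orbT.
have u't : (u' * t = u)%N by rewrite uE mulnC.
case/orP; [|case/orP; [|case/orP; [|case/orP; [|case/orP]]]].
- case/andP=> /eqP -> hl hv; have -> : ((0 * t + l) == u + 1)%N = false by lia.
  by apply: in_range_bounds hl _ _; lia.
- case/andP=> hk hl hv; have kt : (k * t + t <= u)%N.
    by rewrite -mulSnr -u't leq_mul2r; lia.
  have -> : ((k * t + l) == u + 1)%N = false by lia.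
  by apply: in_range_bounds hl _ _; lia.
- case/andP=> /eqP -> hl hv; rewrite u't; case: eqP => // hne.
  by apply: (@in_range_bounds _ _ 2 (t + 1)); lia.
- case/andP=> hk hl hv.
  have kt : (k * t + 2 * t <= 2 * u)%N by rewrite -mulnDl -u't mulnA leq_mul2r; lia.
  have kt' : (u + t <= k * t)%N by rewrite -u't -mulSnr; apply: kut; lia.
  have -> : ((k * t + l) == u + 1)%N = false by lia.
  by apply: in_range_bounds hl _ _; lia.
- case/existsP=> h /and3P[h2 /eqP kE hl] hv; have ht := ltn_ord h.
  have hu' : (0 < h * u')%N by rewrite muln_gt0; lia.
  have kt : (k * t + t = h * u)%N by rewrite -mulSnr -u't mulnA; congr muln; lia.
  have hu : (2 * u <= h * u)%N by rewrite leq_mul2r h2 orbT.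
  have -> : ((k * t + l) == u + 1)%N = false by lia.
  by apply: in_range_bounds hl _ _; lia.
- case/existsP=> h /and3P[h2 hk hl] hv; have ht := ltn_ord h.
  have kt : (h * u <= k * t)%N by rewrite -u't mulnA; apply: kut; lia.
  have kt' : (k * t + 2 * t <= h.+1 * u)%N.
    by rewrite -mulnDl -u't mulnA leq_mul2r; lia.
  have hu : (2 * u <= h * u)%N by rewrite leq_mul2r h2 orbT.
  have -> : ((k * t + l) == u + 1)%N = false by lia.
  by apply: in_range_bounds hl _ _; lia.
Qed.

(** For fixed k, [in_range] confines l to an interval; [lower] and [upper] turn test values into its
    strict bounds, which are those of the table. *)
Let admissible_complete k l : in_range k l -> (1 < k * t + l < v)%N ->
  (k * t + l != u + 1)%N -> admissible u v t u' k l.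
Proof.
rewrite /admissible /in_range => /andP[lo hi] /andP[r_gt1 r_lt] r_ne.
have ku : (k + 2 <= u)%N.
  rewrite leqNgt; apply/negP=> ku; rewrite vE in r_lt; nia.
have [n uS] : exists n, u = (n + 1)%N by exists u.-1; lia.
have u1 : (u - 1 = n)%N by lia.
rewrite u1 in lo hi.
have lower m : (n * m < k * t -> m < l)%N.
  by move=> H; have := leq_trans H lo; rewrite ltn_mul2l => /andP[].
have upper m : ((k + u) * t <= n * m -> l < m)%N.
  by move=> H; have := leq_trans hi H; rewrite ltn_mul2l => /andP[].
clear lo hi.
case: eqP => vu.
  have tu : t = u by rewrite vE in vu; nia.
  have u'1 : u' = 1%N by nia.
  subst t.
  have lk : k = 0%N \/ (k < l)%N.
    have [->|k0] : k = 0%N \/ (0 < k)%N by lia.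
      by left.
    by right; apply: lower; rewrite uS; lia.
  have lu : (l <= u + k + 1)%N.
    have : (l < u + k + 2)%N by apply: upper; rewrite uS; lia.
    by lia.
  case: k {r_lt lower upper} r_gt1 r_ne ku lk lu => [|[|k]] r_gt1 r_ne ku lk lu.
  - by apply/or3P; constructor 1; lia.
  - by apply/or3P; constructor 2; lia.
  - by apply/or3P; constructor 3; lia.
have u'_gt1 : (1 < u')%N.
  case: u' uE => [|[|//]] uE'; first by lia.
  by case: vu; rewrite vE uE' muln1 mulnn.
have ltu : (t + t <= u)%N.
  by rewrite uE addnn -muln2 leq_mul2l u'_gt1 orbT.
(* With k + 1 = h u' + m, the rows of the table are the cases h = 0, h = 1 (m = 0, m = 1, m > 1) and
   h > 1 (m = 0, m > 0). *)
have hE := divn_eq k.+1 u'.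
have hm : (k.+1 %% u' < u')%N by rewrite ltn_mod; lia.
set h := (k.+1 %/ u')%N in hE; set m := (k.+1 %% u')%N in hE hm.
have ktE : (k * t + t = h * u + m * t)%N.
  by rewrite -mulSnr hE uE mulnDl -mulnA [(u' * t)%N]mulnC.
have mt : (m * t + t <= u)%N by rewrite uE -mulSnr mulnC leq_mul2l hm orbT.
have ht : (h < t)%N.
  rewrite ltnNge; apply/negP => th; have : (t * u <= h * u)%N by rewrite leq_mul2r th orbT.
  have : (k.+2 * t <= u * t)%N by rewrite leq_mul2r; lia.
  by lia.
have [h0|[h1|h2]] : h = 0%N \/ h = 1%N \/ (2 <= h)%N by lia.
- rewrite h0 in hE ktE.
  have lt : (l < t + 1)%N by apply: upper; rewrite uS in mt ktE ltu *; lia.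
  have [k0|k0] : k = 0%N \/ (0 < k)%N by lia.
    by apply/orP; left; lia.
  have l0 : (0 < l)%N by apply: lower; rewrite muln0 muln_gt0 k0; lia.
  by apply/orP; right; apply/orP; left; lia.
- rewrite h1 in hE ktE.
  have [m0|[m1|m2]] : m = 0%N \/ m = 1%N \/ (2 <= m)%N by lia.
  + rewrite m0 in hE ktE.
    have l0 : (0 < l)%N by apply: lower; lia.
    have lt : (l < t + 2)%N by apply: upper; rewrite uS in mt ktE ltu *; lia.
    by apply/orP; right; apply/orP; left; lia.
  + rewrite m1 in hE ktE.
    have lt : (l < t + 2)%N by apply: upper; rewrite uS in mt ktE ltu *; lia.
    have l0 : (0 < l)%N by apply: lower; lia.
    by apply/orP; right; apply/orP; right; apply/orP; left; lia.
  + have mt2 : (2 * t <= m * t)%N by rewrite leq_mul2r m2 orbT.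
    have lt : (l < t + 2)%N by apply: upper; rewrite uS in mt ktE ltu *; lia.
    have l1 : (1 < l)%N by apply: lower; rewrite uS in mt ktE ltu *; lia.
    by apply/orP; right; apply/orP; right; apply/orP; right; apply/orP; left; lia.
- apply/orP; right; apply/orP; right; apply/orP; right; apply/orP; right.
  have [m0|m0] : m = 0%N \/ (0 < m)%N by lia.
  + rewrite m0 in hE ktE.
    have l1 : (h.-1 < l)%N.
      by apply: lower; case: (h) h2 ktE => // h' _; rewrite uS in mt ltu *; lia.
    have l2 : (l < t + h + 1)%N by apply: upper; rewrite uS in mt ktE ltu *; lia.
    apply/orP; left; apply/existsP; exists (Ordinal ht) => /=.
    by apply/and3P; split=> //; lia.
  + have mt2 : (t <= m * t)%N by rewrite leq_pmull.
    have l1 : (h < l)%N by apply: lower; rewrite uS in mt ktE ltu *; lia.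
    have l2 : (l < t + h + 1)%N by apply: upper; rewrite uS in mt ktE ltu *; lia.
    apply/orP; right; apply/existsP; exists (Ordinal ht) => /=.
    by apply/and3P; split=> //; lia.
Qed.

Lemma quot_ofE r : (1 < r < v)%N ->
  quot_of u v t u' r = ((u - 1) * r %/ v + (r == u + 1))%N.
Proof.
move=> r_in; rewrite /quot_of; case: pickP => [k /andP[le adm]|none].
  have rE : (k * t + (r - k * t) = r)%N by lia.
  have lt : (k * t + (r - k * t) < v)%N by lia.
  have := admissible_sound adm lt; rewrite rE.
  case: eqP => [ru ->|_ /in_rangeE]; last by rewrite rE addn0.
  have v_gt0 : (0 < v)%N by lia.
  (* (u - 1)(u + 1) = u' v - 1, so the floor falls just short of u'. *)
  have -> : ((u - 1) * r = (u' - 1) * v + (v - 1))%N.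
    rewrite ru vE; have : (0 < u')%N by case: (u') uE => //; lia.
    by rewrite uE; nia.
  by rewrite divnMDl // divn_small; nia.
have [ru|ru] := eqVneq r (u + 1)%N.
  have lt : (u' < r.+1)%N by nia.
  have := none (Ordinal lt); rewrite /= mulnC -uE ru.
  have -> : (u + 1 - u = 1)%N by lia.
  have -> : (u <= u + 1)%N by lia.
  move=> /= /negbT/negP[]; rewrite /admissible; case: eqP => vu.
    by apply/or3P; constructor 2; rewrite vE in vu; nia.
  by apply/orP; right; apply/orP; right; apply/orP; left; lia.
have [le ran] := in_range_div r; set k := (_ %/ _)%N in le ran *.
have lt : (k < r.+1)%N by nia.
have := none (Ordinal lt); rewrite /= le /= => /negbT/negP[].
by apply: admissible_complete => //; lia.
Qed.
End QuotOf.

Lemma bin2_mul2 n : ('C(n, 2) * 2 = n * (n - 1))%N.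
Proof.
rewrite bin2 muln2 -[RHS]odd_double_half subn1 oddM -addnn.
by case: n => //= n; case: odd.
Qed.

Lemma sum1_bin2 n : (\sum_(1 <= s < n) s = 'C(n, 2))%N.
Proof.
case: n => [|n]; first by rewrite big_geq.
by rewrite -bin2_sum [RHS]big_ltn ?add0n.
Qed.

(** * Cocycles of the small complex and their potentials *)

Section SmallComplexTheory.
Variables (u v t u' : nat) (G : zmodType).
Hypotheses (t_gt1 : (1 < t)%N) (u_gt2 : (2 < u)%N).
Hypotheses (uE : u = (t * u')%N) (vE : v = (u * t)%N).
(** What remains of u > 2 being a prime power with u < v. It yields [w_sq_dvd] and the injectivity
    of [sigma] modulo v. *)
Hypothesis par : odd u || ((4 %| u)%N && ~~ odd t).

(** [L] is a natural number representing 1 - u modulo v; [w] is the scalar by which the weighted sum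
    in the last cocycle equation acts on beta. *)
Local Notation L := (1 + u * (t - 1))%N.
Local Notation w := (u' * 'C(t, 2))%N.
Local Notation Z := (X2_Z u v t u' G).
Local Notation B := (X2_B u v G).

Let u'_gt0 : (0 < u')%N.
Proof. by case: u' uE => //; lia. Qed.

Let v_gt1 : (1 < v)%N.
Proof. by rewrite vE; nia. Qed.

Let v_gt2 : (2 < v)%N.
Proof. by rewrite vE; nia. Qed.

Let u_lt_v : (u < v)%N.
Proof. by rewrite vE -{1}[u]muln1 ltn_pmul2l //; lia. Qed.

Let L_add_u : (L + u = v + 1)%N.
Proof. by rewrite vE mulnBr muln1; have := leq_pmulr u (ltnW t_gt1); lia. Qed.

Let uuE : (u * u = u' * v)%N.
Proof. by rewrite vE mulnCA [(u' * t)%N]mulnC -uE. Qed.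

Lemma Zv_natP (n m : nat) : (n = m %[mod v])%N <-> n%:R = m%:R :> 'Z_v.
Proof.
split=> [E|/(congr1 val)]; last by rewrite /= !val_Zp_nat.
by apply: val_inj; rewrite /= !val_Zp_nat.
Qed.

Lemma Zv_ind (K : 'Z_v -> Prop) : (forall n : nat, K n%:R) -> forall x, K x.
Proof. by move=> H x; rewrite -(natr_Zp x). Qed.

Lemma Zv_v0 : v%:R = 0 :> 'Z_v.
Proof. exact: pchar_Zp. Qed.

Lemma Zv_uu0 : u%:R * u%:R = 0 :> 'Z_v.
Proof. by rewrite -natrM uuE natrM Zv_v0 mulr0. Qed.

Lemma sub_uE s : 1 - (s * u)%:R = (1 + u * (t - 1) * s)%:R :> 'Z_v.
Proof.
apply/eqP; rewrite eq_sym -subr_eq0; apply/eqP.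
have -> : (1 + u * (t - 1) * s)%:R - (1 - (s * u)%:R) = (s * v)%:R :> 'Z_v.
  rewrite opprB addrC -addrA [X in _ + X]addrC.
  have -> : (s * v = s * u + u * (t - 1) * s)%N by rewrite vE; nia.
  by rewrite natrD; ring.
by rewrite natrM Zv_v0 mulr0.
Qed.

Lemma sub1_uE : 1 - u%:R = L%:R :> 'Z_v.
Proof. by have := sub_uE 1; rewrite mul1n muln1. Qed.

Lemma uC2E : (u * 'C(t, 2) = t * w)%N.
Proof. by rewrite uE mulnA. Qed.

(** For odd t already u divides w. For t = 2h, w = (u/2)(t - 1), and 4 | u makes (u/2)^2 a multiple
    of u. *)
Lemma w_sq_dvd : (u %| w * w)%N.
Proof.
have C2 := bin2_mul2 t.
have [ot|et] := boolP (odd t).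
  have -> : ('C(t, 2) = t * (t - 1)./2)%N.
    have := odd_double_half (t - 1); lia.
  have -> : (u' * (t * (t - 1)./2) = u * (t - 1)./2)%N by rewrite uE; lia.
  by rewrite -mulnA dvdn_mulr.
have u4 : (4 %| u)%N.
  by case/orP: par => [|/andP[]//]; rewrite uE oddM (negbTE et).
have [h hE] : exists h, t = (h * 2)%N by exists t./2; lia.
have -> : ('C(t, 2) = h * (t - 1))%N by lia.
case/dvdnP: u4 => k kE.
have hk : (u' * h = k * 2)%N by lia.
apply/dvdnP; exists (k * (t - 1) * (t - 1))%N.
by rewrite -!mulnA [(_ * (u' * _))%N]mulnC !mulnA hk kE; lia.
Qed.

Definition norm (al : 'Z_v -> G) (i : 'Z_v) : G :=
  \sum_(0 <= s < t) al ((1 - (s * u)%:R) * i).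

(* P and e n + P (L n) - P n trivialise the cocycle (F, al) after pulling it back *)
(* to the integers.                                                               *)
Definition potential (P : nat -> G) (e g : G) (F : 'Z_v * 'Z_v -> G) (al : 'Z_v -> G) :=
  [/\ P 0%N = 0, forall n, P (n + v)%N = P n + g, e *+ v = g *+ u - g *+ v,
      forall n m, F (n%:R, m%:R) = P (n + m)%N - P n - P m &
      forall n, al n%:R = e *+ n + P (L * n)%N - P n].

Lemma quasi_periodic (P : nat -> G) (g : G) n k :
  (forall m, P (m + v)%N = P m + g) -> P (n + v * k)%N = P n + g *+ k.
Proof.
move=> Pv; elim: k => [|k IH]; first by rewrite muln0 addn0 addr0.
by rewrite mulnS addnCA addnC Pv IH mulrS; zmod.
Qed.

Section Potential.
Variables (P : nat -> G) (e g : G) (F : 'Z_v * 'Z_v -> G) (al : 'Z_v -> G).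
Hypothesis pot : potential P e g F al.

(** The differences of [P] telescope up to multiples of v: since u^2 = u' v, each factor L
    contributes a multiple of g, and u t = v makes the two ends differ by another. The remaining
    terms add up to arithmetic progressions. *)
Lemma norm_potential n :
  norm al n%:R = (e *+ t + g *+ (t - 1)) *+ (n * (1 + (t - 1) * w)).
Proof.
case: pot => P0 Pv ve _ alE; rewrite /norm.
have step s : al ((1 - (s * u)%:R) * n%:R) =
    e *+ n + e *+ (u * (t - 1) * n * s) + g *+ (u' * (t - 1) * (t - 1) * n * s)
    + (P ((1 + u * (t - 1) * s.+1) * n)%N - P ((1 + u * (t - 1) * s) * n)%N).
  rewrite sub_uE -natrM alE.
  have -> : (L * ((1 + u * (t - 1) * s) * n) = (1 + u * (t - 1) * s.+1) * n
             + v * (u' * (t - 1) * (t - 1) * n * s))%N.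
    rewrite mulnC !mulnA [(v * u')%N]mulnC -uuE; lia.
  by rewrite (quasi_periodic _ _ Pv); zmod.
rewrite (eq_bigr _ (fun s _ => step s)) big_split /=.
rewrite [X in _ + X](telescope_sumr_eq (fun s => P ((1 + u * (t - 1) * s) * n)%N)) //.
rewrite !big_split /= sumr_const_nat subn0.
under [\sum_(_ <= _ < _) e *+ (_ * _)]eq_bigr do rewrite mulrnA.
under [\sum_(_ <= _ < _) g *+ (_ * _)]eq_bigr do rewrite mulrnA.
rewrite !sumrMnr !bin2_sum.
have -> : ((1 + u * (t - 1) * t) * n = n + v * ((t - 1) * n))%N by rewrite vE; lia.
rewrite muln0 addn0 mul1n (quasi_periodic _ _ Pv) uE.
by move: (t - 1)%N 'C(t, 2) (P n) => r c x; zmod.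
Qed.

(** With ga1 = e + g the element is t ga1 - ga; as v = u t, the relation in [potential] says
    precisely that it is u-torsion. *)
Lemma potential_delta : (e *+ t + g *+ (t - 1)) *+ u = 0.
Proof.
case: pot => _ _ ve _ _.
have -> : 0 = (e *+ v - (g *+ u - g *+ v)) by rewrite ve subrr.
rewrite vE; have : t = (t - 1 + 1)%N by lia.
by move: (t - 1)%N => r ->; zmod.
Qed.

(** The equations for F and alpha hold formally. For beta = - n d with u d = 0, [norm_potential]
    reduces the last one to t w d = 0, which follows from t w = u C(t, 2). *)
Lemma potential_in_Z (be : {ffun 'Z_v -> G}) (F' : {ffun 'Z_v * 'Z_v -> G})
    (al' : {ffun 'Z_v -> G}) : F =1 F' -> al =1 al' ->
  (forall n : nat, be n%:R = - (e *+ t + g *+ (t - 1)) *+ n) ->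
  (F', al', be) \in Z.
Proof.
move=> FF' aa' beE; case: (pot) => P0 Pv ve FE alE.
have du := potential_delta; set d := _ + _ in du beE.
have dL n m : d *+ ((1 + u * n) * m) = d *+ m.
  by rewrite mulnDl mul1n mulrnDr -mulnA mulrnA du mul0rn addr0.
have beL n (i : 'Z_v) : be ((1 - (n * u)%:R) * i) = be i.
  rewrite sub_uE; elim/Zv_ind: i => m; rewrite -natrM !beE !mulNrn.
  by rewrite -mulnA dL.
apply/asboolP; split; split.
- elim/Zv_ind=> n; elim/Zv_ind=> m; rewrite -!FF' !FE addnC; zmod.
- by elim/Zv_ind=> m; rewrite -FF' -[0]/(0%:R) FE P0 add0n; zmod.
- by rewrite -aa' -[0]/(0%:R) alE muln0 P0; zmod.
- by rewrite -[0]/(0%:R) beE mulr0n.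
- elim/Zv_ind=> a; elim/Zv_ind=> b; elim/Zv_ind=> c.
  by rewrite -!natrD -!FF' !FE !addnA; zmod.
- elim/Zv_ind=> i; elim/Zv_ind=> j.
  by rewrite sub1_uE -!natrM -!natrD -!FF' -!aa' !FE !alE mulnDr; zmod.
- by elim/Zv_ind=> i; elim/Zv_ind=> j; rewrite -natrD !beE mulrnDr.
- move=> i; split; first by rewrite -{1}[u]mul1n beL.
  by elim/Zv_ind: i => i; rewrite beE -mulrnA mulnC mulrnA mulNrn du oppr0 mul0rn.
elim/Zv_ind=> i.
under [X in _ + X *+ _]eq_bigr do rewrite beL.
rewrite sumrMnr.
have <- : norm al i%:R = \sum_(0 <= s < t) al' ((1 - (s * u)%:R) * i%:R).
  by apply: eq_bigr => s _; rewrite aa'.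
rewrite sum1_bin2.
rewrite norm_potential beE -/d.
have -> : 0 = - (d *+ u *+ ('C(t, 2) * i)) by rewrite du mul0rn oppr0.
have C : (u * 'C(t, 2) = (t - 1) * w + w)%N by rewrite uC2E; nia.
rewrite -!mulrnA [(u * _)%N]mulnA C.
by move: 'C(t, 2) (t - 1)%N (d) => c r x; zmod.
Qed.
End Potential.

Lemma X2_eq (x y : X2 v G) : x.1.1 = y.1.1 -> x.1.2 = y.1.2 -> x.2 = y.2 -> x = y.
Proof. by case: x y => [[? ?] ?] [[? ?] ?] /= -> -> ->. Qed.

Lemma cocycle_norm (x : X2 v G) (i : 'Z_v) :
  x \in Z -> norm x.1.2 i = x.2 i *+ w - x.2 i /\ x.2 i *+ u = 0.
Proof.
case: x => [[F al] be] /asboolP[_ [_ _ _ bL nE]] /=; move: (nE i).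
have beL n : be ((1 - (n * u)%:R) * i) = be i.
  elim: n => [|n IH]; first by rewrite mul0n subr0 mul1r.
  rewrite -[RHS]IH -[RHS](bL _).1 mulrA; congr (be (_ * i)).
  rewrite mulSn natrD natrM; have := Zv_uu0; move: (u%:R : 'Z_v) (n%:R : 'Z_v).
  by move=> a b aa; ring: aa.
under [X in _ + X *+ _]eq_bigr do rewrite beL.
rewrite sumrMnr sum1_bin2.
rewrite -/(norm al i) => /eqP; rewrite -mulrnA addr_eq0 -opprD eqr_opp mulnC.
by move=> /eqP E; split; [rewrite -E addrK|exact: (bL i).2].
Qed.

Lemma mulrn_w_sq (y : G) : y *+ u = 0 -> y *+ (w * w) = 0.
Proof. by move=> yu; have /dvdnP[k ->] := w_sq_dvd; rewrite mulnC mulrnA yu mul0rn. Qed.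

(** The norm of alpha is (w - 1) beta, and (1 - w)(1 + w) = 1 - w^2 acts as 1 on the u-torsion
    element beta(i). *)
Lemma cocycle_beta (x : X2 v G) (i : 'Z_v) :
  x \in Z -> x.2 i = - norm x.1.2 i *+ (1 + w).
Proof.
move=> /(cocycle_norm i)[-> /mulrn_w_sq].
move: w (x.2 i) => W b H; rewrite mulNrn mulrnBl !mulrnDr !mulr1n -mulrnA H.
by zmod.
Qed.

Lemma cocycle_eq (x y : X2 v G) : x \in Z -> y \in Z ->
  x.1.1 =1 y.1.1 -> x.1.2 =1 y.1.2 -> x = y.
Proof.
move=> xZ yZ /ffunP E1 /ffunP E2; apply: X2_eq => //.
by apply/ffunP => i; rewrite !cocycle_beta // E2.
Qed.

Lemma cocycleP (x : X2 v G) : x \in Z ->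
  [/\ forall i j, x.1.1 (i, j) = x.1.1 (j, i), forall j, x.1.1 (0, j) = 0,
      forall a b c, x.1.1 (b, c) - x.1.1 (a + b, c) + x.1.1 (a, b + c) - x.1.1 (a, b) = 0 &
      forall i j, x.1.2 i + x.1.2 j - x.1.2 (i + j)
        + x.1.1 ((1 - u%:R) * i, (1 - u%:R) * j) - x.1.1 (i, j) = 0].
Proof. by case: x => [[F al] be] /asboolP[[Fs F0 _ _] [FZ aZ _ _ _]]. Qed.

Section CocyclePotential.
Variables (x : X2 v G).
Hypothesis xZ : x \in Z.

Definition cocycle_pot (x : X2 v G) (n : nat) : G := \sum_(0 <= k < n) x.1.1 (1, k%:R).
(* On z(ga1, ga) these two functionals return ga and ga1; on the coboundary of th *)
(* they return - v th(1) and - u th(1).                                           *)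
Definition invariant_ga (x : X2 v G) : G := cocycle_pot x v.
Definition invariant_ga1 (x : X2 v G) : G :=
  x.1.2 1 + \sum_(v + 1 - u <= k < v) x.1.1 (1, k%:R).

Local Notation P := (cocycle_pot x).

Lemma cocycle_pot0 : P 0 = 0.
Proof. by rewrite /cocycle_pot big_geq. Qed.

Lemma cocycle_potS n : P n.+1 = P n + x.1.1 (1, n%:R).
Proof. by rewrite /cocycle_pot big_nat_recr. Qed.

Lemma cocycle_potP (n m : nat) : x.1.1 (n%:R, m%:R) = P (n + m)%N - P n - P m.
Proof.
have [_ F0 FZ _] := cocycleP xZ.
elim: n => [|n IH]; first by rewrite F0 add0n cocycle_pot0; zmod.
rewrite addSn !cocycle_potS.
have := FZ 1%:R n%:R m%:R; rewrite IH -!natrD !add1n mulr1n => /eqP.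
rewrite subr_eq0 => /eqP <-; zmod.
Qed.

Lemma cocycle_pot_v n : P (n + v)%N = P n + invariant_ga x.
Proof.
have [Fs F0 _ _] := cocycleP xZ; have := cocycle_potP n v.
rewrite Zv_v0 Fs F0 => /esym/eqP; rewrite subr_eq0 subr_eq => /eqP ->.
by rewrite addrC.
Qed.

Lemma cocycle_potential :
  potential P (invariant_ga1 x - invariant_ga x) (invariant_ga x) x.1.1 x.1.2.
Proof.
have [Fs F0 _ aZ] := cocycleP xZ; have PP := cocycle_potP; have Pv := cocycle_pot_v.
have P0 := cocycle_pot0.
have P1 : P 1 = 0.
  by rewrite cocycle_potS P0 add0r Fs F0.
have LE : (v + 1 - u = L)%N by rewrite -L_add_u addnK.
have L_lt : (L < v)%N by have := u_gt2; rewrite -LE; lia.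
(* Compatibility of alpha with F makes [D] additive, hence linear; comparing [D v] with alpha(0) = 0
   gives the relation between the invariants. *)
pose D n := x.1.2 n%:R - P (L * n)%N + P n.
have DD n m : D (n + m)%N = D n + D m.
  rewrite /D mulnDr; have := PP (L * n)%N (L * m)%N; have := PP n m.
  rewrite !natrM -sub1_uE => E1 E2; have := aZ n%:R m%:R; rewrite E1 E2 -natrD => E.
  apply/eqP; rewrite eq_sym -subr_eq0; apply/eqP; rewrite -[RHS]E; zmod.
have Dn n : D n = D 1 *+ n.
  elim: n => [|n IH]; last by rewrite -addn1 DD IH mulrnDr.
  by have /eqP := DD 0%N 0%N; rewrite add0n eq_sym -subr_eq0 addrK => /eqP.
have D1 : D 1%N = invariant_ga1 x - invariant_ga x.
  have E : P v = P L + \sum_(L <= k < v) x.1.1 (1, k%:R).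
    by rewrite /cocycle_pot -big_cat_nat // ltnW.
  rewrite /D /invariant_ga1 muln1 P1 LE /invariant_ga E.
  by move: (P L) (x.1.2 1) (\sum_(L <= k < v) _) => a b c; zmod.
split=> // [|n]; last by rewrite -D1 -Dn /D; zmod.
rewrite -D1 -Dn.
have D0 : D 0%N = 0 by rewrite Dn mulr0n.
have a0 : x.1.2 0 = 0 by rewrite -[RHS]D0 /D muln0 P0 subr0 addr0.
have Pvk := quasi_periodic 0 _ Pv.
have E1 : P (L * v)%N = invariant_ga x *+ L.
  by rewrite mulnC -[(v * L)%N]add0n Pvk P0 add0r.
have E2 : P v = invariant_ga x by [].
rewrite /D Zv_v0 a0 E1 E2.
have -> : invariant_ga x *+ v = invariant_ga x *+ (v - u) + invariant_ga x *+ u.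
  by rewrite -mulrnDr subnK // ltnW.
rewrite -LE; have -> : (v + 1 - u = (v - u) + 1)%N by lia.
by zmod.
Qed.
End CocyclePotential.

(* Summing f1 ga along its row of index 1 gives this potential. *)
Definition zco_pot (ga : G) (n : nat) : G := ga *+ (n %/ v + (1 < n %% v))%N.

Lemma zco_pot_v ga n : zco_pot ga (n + v) = zco_pot ga n + ga.
Proof. by rewrite /zco_pot modnDr divnDr // divnn (ltnW v_gt1) addnAC mulrnDr. Qed.

Lemma f1_pot ga n m : f1 v ga (n%:R : 'Z_v, m%:R) =
  zco_pot ga (n + m) - zco_pot ga n - zco_pot ga m.
Proof.
(* Quasi-periods cancel in the coboundary, so representatives below v suffice. *)
have red k l : zco_pot ga (k + l) - zco_pot ga k - zco_pot ga l =
    zco_pot ga (k %% v + l %% v) - zco_pot ga (k %% v) - zco_pot ga (l %% v).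
  have E a b : zco_pot ga (a + v * b)%N = zco_pot ga a + ga *+ b.
    exact: quasi_periodic (zco_pot_v ga).
  rewrite {1 2}(divn_eq k v) {1 2}(divn_eq l v) ![(_ %/ _ * v)%N]mulnC.
  have -> : (v * (k %/ v) + k %% v + (v * (l %/ v) + l %% v) =
    (k %% v + l %% v) + v * (k %/ v + l %/ v))%N by lia.
  by rewrite ![(v * (_ %/ _) + _)%N]addnC !E; zmod.
rewrite red ffunE /= !val_Zp_nat //.
have := ltn_pmod n (ltnW v_gt1); have := ltn_pmod m (ltnW v_gt1).
move: (n %% v)%N (m %% v)%N => i j hj hi; rewrite /zco_pot.
rewrite !(divn_small hi) !(divn_small hj) !(modn_small hi) !(modn_small hj) !add0n.
have [lt|ge] := ltnP (i + j) v.
  rewrite (divn_small lt) (modn_small lt) add0n.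
  case: i hi lt => [|[|i]] hi lt; case: j hj lt => [|[|j]] hj lt //=;
    rewrite ?mulr0n ?mulr1n ?subr0 ?subrr //; try zmod.
  - by rewrite ifT ?sub0r //; lia.
have -> : (i + j = (i + j - v) + v)%N by lia.
have lt : (i + j - v < v)%N by lia.
rewrite divnDr // divnn (ltnW v_gt1) modnDr (divn_small lt) (modn_small lt) add0n.
have [i1|i1] : (1 < i)%N \/ i = 1%N by lia.
  have [j1|j1] : (1 < j)%N \/ j = 1%N by lia.
    rewrite i1 j1 (_ : (i == 1%N) = false) /=; last by lia.
    have [le|gt] := leqP 2 (i + j - v).
      by rewrite ifF; [rewrite /= ?addn0; zmod|lia].
    by rewrite ifT; [rewrite /= ?addn0; zmod|lia].
  rewrite j1 i1 andbF /= ifF; last by lia.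
  by rewrite (_ : (1 < _)%N = false); [rewrite /= ?addn0; zmod|lia].
rewrite i1 eqxx; case: eqP => [j1|j1] /=; first by lia.
rewrite (_ : (1 < 1 + j - v)%N = false); last by lia.
by rewrite (_ : (1 < j)%N); [rewrite /= ?addn0; zmod|lia].
Qed.

Let coprime_u1 : coprime v (u - 1).
Proof.
have cu : coprime u (u - 1) by rewrite subn1 coprimenP //; lia.
rewrite vE coprimeMl cu /=; apply: coprime_dvdl cu.
by rewrite [X in (_ %| X)%N]uE dvdn_mulr.
Qed.

(** Since L r = v r - (u - 1) r, dividing (u - 1) r by v as q v + m gives L r = (r - q - 1) v + (v -
    m), where m > 0 because u - 1 is prime to v. The remainder v - m is 1 only at r = u + 1, exactly
    where [quot_of] exceeds q by one. *)
Lemma quot_of_L r : (1 < r < v)%N ->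
  (L * r %/ v + (1 < (L * r) %% v) + quot_of u v t u' r = r)%N.
Proof.
move=> r_in; rewrite (quot_ofE t_gt1 u_gt2 uE vE r_in).
have v_gt0 := ltnW v_gt1.
have := divn_eq ((u - 1) * r) v; have := ltn_pmod ((u - 1) * r) v_gt0.
set q := (_ %/ v)%N; set m := (_ %% v)%N => m_lt E.
have m_gt0 : (0 < m)%N.
  rewrite lt0n; apply/negP => m0; have : (v %| (u - 1) * r)%N by apply/eqP/eqP.
  by rewrite Gauss_dvdr // => /dvdn_leq; lia.
have mE : (m == v - 1)%N = (r == u + 1)%N.
  have u1_lt : (u + 1 < v)%N by rewrite vE; have := leq_mul (leqnn u) t_gt1; lia.
  have E1 : ((u - 1) * (u + 1) + 1 = u' * v)%N by rewrite -uuE; nia.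
  apply/eqP/eqP => [mE|rE]; last first.
    have u'_pos := u'_gt0.
    have E2 : ((u - 1) * r = (u' - 1) * v + (v - 1))%N.
      have E0 : ((u' - 1) * v + v = u' * v)%N by rewrite -mulSnr; congr muln; lia.
      by rewrite rE; lia.
    by rewrite /m E2 modnMDl modn_small; lia.
  have E2 : ((u - 1) * r + 1 = (q + 1) * v)%N by rewrite E mE mulnDl; lia.
  have dv a b : (a <= b)%N -> (v %| (u - 1) * a + 1)%N ->
      (v %| (u - 1) * b + 1)%N -> (v %| b - a)%N.
    move=> ab da db; rewrite -(Gauss_dvdr _ coprime_u1) mulnBr.
    by rewrite -(subnDr 1) dvdn_sub.
  have d1 : (v %| (u - 1) * r + 1)%N by rewrite E2 dvdn_mull.
  have d2 : (v %| (u - 1) * (u + 1) + 1)%N by rewrite E1 dvdn_mull.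
  have [le|le] := leqP r (u + 1).
    have := dv _ _ le d1 d2; case: (posnP (u + 1 - r)) => [|pos /(dvdn_leq pos)]; lia.
  have := dv _ _ (ltnW le) d2 d1; case: (posnP (r - (u + 1))) => [|pos /(dvdn_leq pos)]; lia.
have qr : (q < r)%N.
  rewrite -(ltn_pmul2r v_gt0); apply: (@leq_ltn_trans ((u - 1) * r)).
    by rewrite E leq_addr.
  by rewrite mulnC ltn_pmul2l; lia.
have -> : (L * r = (r - q - 1) * v + (v - m))%N.
  have LE : (L + (u - 1) = v)%N by have := L_add_u; lia.
  have E3 : (L * r + (u - 1) * r = v * r)%N by rewrite -mulnDl LE.
  have E4 : (r = (r - q - 1) + q + 1)%N by lia.
  have : (v * r = (r - q - 1) * v + q * v + v)%N by rewrite {1}E4; lia.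
  lia.
have lt : (v - m < v)%N by lia.
rewrite divnMDl // modnMDl (divn_small lt) (modn_small lt) -mE; case: eqP; lia.
Qed.

(** The relation makes the right-hand side v-periodic. For 1 < r < v the potential is ga at r and,
    by [quot_of_L], (r - k) ga at L r, which leaves r ga1 - (k + 1) ga. *)
Lemma family_pot ga1 ga n : ga1 *+ v = ga *+ u ->
  Defs.family u v t u' ga1 ga n%:R =
    (ga1 - ga) *+ n + zco_pot ga (L * n) - zco_pot ga n.
Proof.
move=> rel; rewrite ffunE /= val_Zp_nat //.
have qp := quasi_periodic _ _ (zco_pot_v ga).
have LE := L_add_u.
have -> : (ga1 - ga) *+ n + zco_pot ga (L * n) - zco_pot ga n =
   (ga1 - ga) *+ (n %% v) + zco_pot ga (L * (n %% v)) - zco_pot ga (n %% v).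
  rewrite {1 2 3}(divn_eq n v) mulnDr ![(n %/ v * v + _)%N]addnC.
  rewrite [(L * (_ * v) + _)%N]addnC mulnCA.
  have -> : (n %/ v * (L * v) = v * (L * (n %/ v)))%N by lia.
  rewrite [(n %/ v * v)%N]mulnC !qp; move: (n %/ v)%N => k.
  have E : ga *+ (L * k) = ga *+ (v * k) + ga *+ k - ga1 *+ v *+ k.
    apply/eqP; rewrite eq_sym subr_eq eq_sym rel -!mulrnA -!mulrnDr -!mulnDl LE.
    by rewrite mulnDl mul1n.
  by rewrite E; move: (zco_pot ga _) (zco_pot ga _) => a b; zmod.
have := ltn_pmod n (ltnW v_gt1); move: (n %% v)%N => r r_lt.
have P0 : zco_pot ga 0 = 0 by rewrite /zco_pot div0n mod0n.
have P1 : zco_pot ga 1 = 0 by rewrite /zco_pot divn_small // modn_small.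
have P2 k : (1 < k < v)%N -> zco_pot ga k = ga.
  by case/andP=> k1 k2; rewrite /zco_pot divn_small // modn_small // k1.
case: eqP => [->|r0]; first by rewrite muln0 P0; zmod.
case: eqP => [->|r1].
  have Lg : (0 < u * (t - 1))%N by rewrite muln_gt0; lia.
  by rewrite muln1 P1 P2; [zmod|lia].
have r_in : (1 < r < v)%N by lia.
rewrite (P2 r) // {1}/zco_pot; have := quot_of_L r_in.
move: (_ + _)%N (quot_of _ _ _ _ _) => a b <-; zmod.
Qed.

Lemma zco_potential ga1 ga : ga1 *+ v = ga *+ u ->
  potential (zco_pot ga) (ga1 - ga) ga (f1 v ga) (Defs.family u v t u' ga1 ga).
Proof.
move=> rel; split; [|exact: zco_pot_v| |exact: f1_pot|].
- by rewrite /zco_pot div0n mod0n.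
- by rewrite mulrnBl rel.
by move=> n; exact: family_pot.
Qed.

Lemma X2_d_potential (th : {ffun 'Z_v -> G}) : th 0 = 0 ->
  potential (fun n => th n%:R) 0 0 (X2_d u th).1.1 (X2_d u th).1.2.
Proof.
move=> th0; split=> [//|n||n m|n]; rewrite ?ffunE /=.
- by rewrite natrD Zv_v0 !addr0.
- by rewrite !mul0rn subrr.
- by rewrite natrD.
- by rewrite sub1_uE natrM mul0rn add0r.
Qed.

Lemma delta_zco (ga1 ga : G) : (ga1 - ga) *+ t + ga *+ (t - 1) = ga1 *+ t - ga.
Proof.
have : t = (t - 1 + 1)%N by lia.
by move: (t - 1)%N => r ->; zmod.
Qed.

Lemma zco_in_Z ga1 ga : ga1 *+ v = ga *+ u -> zco u v t u' G ga1 ga \in Z.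
Proof.
move=> rel; have pot := zco_potential rel.
apply: (potential_in_Z pot) => // n; rewrite delta_zco.
have := potential_delta pot; rewrite delta_zco => du.
rewrite ffunE val_Zp_nat // mulNrn {2}(divn_eq n v) mulrnDr.
by rewrite [(n %/ v * v)%N]mulnC vE -!mulnA mulrnA du mul0rn add0r.
Qed.

Lemma X2_d_in_Z (th : {ffun 'Z_v -> G}) : th 0 = 0 -> X2_d u th \in Z.
Proof.
move=> th0; apply: (potential_in_Z (X2_d_potential th0)) => // n.
by rewrite ffunE !mul0rn addr0 oppr0 mul0rn.
Qed.

(** The invariants use the potential that vanishes at 1; passing to it subtracts the linear function
    n P(1). *)
Lemma potential_invariants P e g (x : X2 v G) : potential P e g x.1.1 x.1.2 ->
  invariant_ga x = g - P 1%N *+ v /\ invariant_ga1 x = e + g - P 1%N *+ u.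
Proof.
move=> [P0 Pv ve FE alE].
have sumE n m : (n <= m)%N ->
    \sum_(n <= k < m) x.1.1 (1, k%:R) = P m - P n - P 1%N *+ (m - n).
  move=> le; rewrite (telescope_sumr_eq (fun k => P k - P 1%N *+ k)) //.
    by rewrite mulrnBr //; zmod.
  by move=> k _; rewrite -[1]/(1%:R) FE add1n mulrS; zmod.
split.
  by rewrite /invariant_ga /cocycle_pot sumE // subn0 P0 -[v in P v]add0n Pv P0; zmod.
have LE : (v + 1 - u = L)%N by rewrite -L_add_u addnK.
have LE' : (v - L = u - 1)%N by lia.
have L_le : (L <= v)%N by lia.
have a1 : x.1.2 1 = e + P L - P 1%N by have := alE 1%N; rewrite muln1.
have Pv1 : P v = g by rewrite -[v in P v]add0n Pv P0 add0r.
rewrite /invariant_ga1 LE (sumE _ _ L_le) a1 Pv1 LE'.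
have -> : P 1%N *+ u = P 1%N *+ (u - 1) + P 1%N by rewrite -mulrSr; congr (_ *+ _); lia.
by move: (P L) (P 1%N) => a b; zmod.
Qed.

Lemma zco_invariants ga1 ga : ga1 *+ v = ga *+ u ->
  let z := zco u v t u' G ga1 ga in invariant_ga z = ga /\ invariant_ga1 z = ga1.
Proof.
move=> rel z; have [] := @potential_invariants _ _ _ z (zco_potential rel).
have -> : zco_pot ga 1 = 0 by rewrite /zco_pot divn_small // modn_small.
by rewrite !mul0rn !subr0 subrK.
Qed.

Lemma X2_d_invariants (th : {ffun 'Z_v -> G}) : th 0 = 0 ->
  invariant_ga (X2_d u th) = - th 1 *+ v /\ invariant_ga1 (X2_d u th) = - th 1 *+ u.
Proof.
by move=> th0; have [-> ->] := potential_invariants (X2_d_potential th0);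
  rewrite !addr0 !sub0r !mulNrn.
Qed.

Lemma invariants_rel (x : X2 v G) : x \in Z -> invariant_ga1 x *+ v = invariant_ga x *+ u.
Proof.
move=> xZ; have [_ _ ve _ _] := cocycle_potential xZ.
by move: ve; rewrite mulrnBl => /addIr.
Qed.

(** Both cocycles have the same quasi-period and slope, so the difference of their potentials
    descends to Z/v; it is [th]. *)
Lemma cocycle_decomp (x : X2 v G) : x \in Z ->
  exists2 th : {ffun 'Z_v -> G}, th 0 = 0 &
    x = zco u v t u' G (invariant_ga1 x) (invariant_ga x) + X2_d u th.
Proof.
move=> xZ; have pot := cocycle_potential xZ; have rel := invariants_rel xZ.
have zpot := zco_potential rel; have zZ := zco_in_Z rel.
set g1 := invariant_ga1 x in pot rel zpot zZ *.
set g := invariant_ga x in pot rel zpot zZ *.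
case: pot zpot => P0 Pv _ FE alE [Q0 Qv _ zFE zalE].
pose D n := cocycle_pot x n - zco_pot g n.
have Dv n : D (n + v)%N = D n by rewrite /D Pv Qv; zmod.
pose th : {ffun 'Z_v -> G} := [ffun i : 'Z_v => D i].
have thE n : th n%:R = D n.
  rewrite ffunE val_Zp_nat // {2}(divn_eq n v) addnC mulnC.
  by rewrite (@quasi_periodic D 0) ?mul0rn ?addr0 // => m; rewrite addr0.
have th0 : th 0 = 0 by rewrite -[0]/(0%:R) thE /D P0 Q0 subrr.
exists th => //; apply: cocycle_eq => //.
- by rewrite rpredD // X2_d_in_Z.
- case=> i j; elim/Zv_ind: i => n; elim/Zv_ind: j => m.
  by rewrite FE [RHS]ffunE zFE ffunE /= -natrD !thE /D; zmod.
- elim/Zv_ind=> n; rewrite alE [RHS]ffunE zalE ffunE /= sub1_uE -natrM !thE /D.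
  by zmod.
Qed.

Lemma zco_B ga : zco u v t u' G (ga *+ u) (ga *+ v) \in B.
Proof.
have rel : ga *+ u *+ v = ga *+ v *+ u by rewrite -!mulrnA mulnC.
have zpot := zco_potential rel; have zZ := zco_in_Z rel.
case: zpot => Q0 Qv _ zFE zalE.
(* The linear term cancels the quasi-period v ga, so [D] descends to Z/v. *)
pose D n := zco_pot (ga *+ v) n - ga *+ n.
have Dv n : D (n + v)%N = D n by rewrite /D Qv; zmod.
pose th : {ffun 'Z_v -> G} := [ffun i : 'Z_v => D i].
have thE n : th n%:R = D n.
  rewrite ffunE val_Zp_nat // {2}(divn_eq n v) addnC mulnC.
  by rewrite (@quasi_periodic D 0) ?mul0rn ?addr0 // => m; rewrite addr0.
have th0 : th 0 = 0 by rewrite -[0]/(0%:R) thE /D Q0 subrr.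
apply/asboolP; exists th; split=> //; apply: cocycle_eq => //.
- exact: X2_d_in_Z.
- case=> i j; elim/Zv_ind: i => n; elim/Zv_ind: j => m.
  by rewrite zFE ffunE /= -natrD !thE /D; zmod.
- elim/Zv_ind=> n; rewrite zalE ffunE /= sub1_uE -natrM !thE /D.
  have -> : ga *+ v = ga *+ (u * (t - 1)) + ga *+ u.
    by rewrite -mulrnDr; congr (_ *+ _); rewrite vE mulnBr muln1 subnK // leq_pmulr // ltnW.
  by zmod.
Qed.

Lemma B_invariants (x : X2 v G) : x \in B ->
  exists ga, invariant_ga x = ga *+ v /\ invariant_ga1 x = ga *+ u.
Proof. by move=> /asboolP[th [th0 ->]]; exists (- th 1); exact: X2_d_invariants. Qed.

Lemma Z_B_invariants (x : X2 v G) ga : x \in Z ->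
  invariant_ga x = ga *+ v -> invariant_ga1 x = ga *+ u -> x \in B.
Proof.
move=> xZ E E1; have [th th0 ->] := cocycle_decomp xZ.
by rewrite E E1 rpredD ?zco_B //; apply/asboolP; exists th.
Qed.

Lemma zcoB (a1 a b1 b : G) :
  zco u v t u' G (a1 - b1) (a - b) = zco u v t u' G a1 a - zco u v t u' G b1 b.
Proof.
apply: X2_eq; apply/ffunP => i; rewrite !ffunE /=.
- by repeat case: ifP => _; zmod.
- by repeat case: ifP => _; zmod.
- by zmod.
Qed.

Lemma invariant_gaB : zmod_morphism invariant_ga.
Proof.
move=> x y; rewrite /invariant_ga /cocycle_pot -sumrB.
by apply: eq_bigr => k _; rewrite !ffunE.
Qed.

Lemma invariant_ga1B : zmod_morphism invariant_ga1.
Proof.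
move=> x y; rewrite /invariant_ga1 opprD addrACA -sumrB !ffunE.
by congr (_ + _); apply: eq_bigr => k _; rewrite !ffunE.
Qed.

(** The default 0 makes the function total; on cocycles the element is u-torsion by
    [invariants_rel], and the default is not reached. *)
Definition cocycle_torsion (x : X2 v G) : torsion G u :=
  insubd 0 (invariant_ga1 x *+ t - invariant_ga x).

Lemma cocycle_torsionE (x : X2 v G) : x \in Z ->
  val (cocycle_torsion x) = invariant_ga1 x *+ t - invariant_ga x.
Proof.
move=> xZ; rewrite insubdK //; apply/eqP; rewrite mulrnBl -mulrnA mulnC -vE.
by rewrite invariants_rel // subrr.
Qed.

Lemma cocycle_torsionB x y : x \in Z -> y \in Z ->
  cocycle_torsion (x - y) = cocycle_torsion x - cocycle_torsion y.
Proof.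
move=> xZ yZ; apply: val_inj; rewrite raddfB /= !cocycle_torsionE ?rpredB //.
by rewrite invariant_gaB invariant_ga1B; zmod.
Qed.

(** Source of surjectivity: any ga1 and any u-torsion d arise from ga = t ga1 - d. *)
Lemma torsion_rel (ga1 : G) (d : torsion G u) :
  ga1 *+ v = (ga1 *+ t - val d) *+ u.
Proof.
rewrite mulrnBl -mulrnA mulnC -vE; case: d => d /= /eqP ->.
by rewrite subr0.
Qed.

(** The first isomorphism theorem for x |-> (ga1 mod u, t ga1 - ga). An x in the kernel has ga1 = u
    c and ga = t u c = v c, the invariants of a coboundary. *)
Lemma small_complex_cohomology :
  let H2 := H2X u v t u' G in
  let z := zco u v t u' G in
  zmod_isog H2 (quo_multiples G u * torsion G u)%type /\
  exists Zbar : zmodClosed (X2 v G),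
    [/\ forall x : X2 v G, x \in Zbar <->
          exists ga1 ga : G, ga1 *+ v = ga *+ u /\ x = z ga1 ga,
        {subset Zbar <= Z},
        forall c : H2, exists x : subgp Z,
          val x \in Zbar /\ subquot_class B x = c,
        forall x : X2 v G, (x \in B) && (x \in Zbar) <->
          exists ga : G, x = z (ga *+ u) (ga *+ v) &
        exists Theta : {additive subgp Zbar -> (G * torsion G u)%type},
          [/\ forall (x : subgp Zbar) (ga1 ga : G),
                ga1 *+ v = ga *+ u -> val x = z ga1 ga ->
                (Theta x).1 = ga1 /\ subgp_val (Theta x).2 = ga1 *+ t - ga,
              bijective Theta &
              exists Theta' : {additive H2 -> (quo_multiples G u * torsion G u)%type},
                bijective Theta' /\
                forall (x : subgp Zbar) (y : subgp Z), val y = val x ->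
                  Theta' (subquot_class B y) =
                    (quo_multiples_class u (Theta x).1, (Theta x).2)]].
Proof.
move=> H2 z.
pose S : {pred X2 v G} :=
  [pred x | `[< exists ga1 ga : G, ga1 *+ v = ga *+ u /\ x = z ga1 ga >]].
have Sc : zmod_closed S.
  split=> [|x y /asboolP[a1 [a [ra ->]]] /asboolP[b1 [b [rb ->]]]]; apply/asboolP.
    exists (0 - 0), (0 - 0); rewrite /z zcoB !subrr; split=> //.
    by rewrite !mul0rn.
  by exists (a1 - b1), (a - b); rewrite /z zcoB !mulrnBl ra rb.
have [Zbar ZbarE] := mk_zmodClosed Sc.
have ZbarP x : x \in Zbar <-> exists ga1 ga : G, ga1 *+ v = ga *+ u /\ x = z ga1 ga.
  by rewrite ZbarE; split=> /asboolP.
have ZbarZ : {subset Zbar <= Z}.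
  by move=> x /ZbarP[a1 [a [ra ->]]]; exact: zco_in_Z.
have valZ (x : subgp Z) : val x \in Z by exact: valP.
have valZbar (x : subgp Zbar) : val x \in Zbar by exact: valP.
have valZbarZ (x : subgp Zbar) : val x \in Z by apply: ZbarZ; exact: valP.
pose phi (x : subgp Z) : (quo_multiples G u * torsion G u)%type :=
  (quo_multiples_class u (invariant_ga1 (val x)), cocycle_torsion (val x)).
have phiB : zmod_morphism phi.
  move=> x y; rewrite /phi raddfB /= invariant_ga1B quo_multiples_classB.
  by rewrite (cocycle_torsionB (valZ x) (valZ y)).
have phi_ker x : (phi x == 0) = (val x \in B).
  apply/eqP/idP => [[/eqP]|xB].
    rewrite quo_multiples_class_eq0 => /asboolP[ga E] /(congr1 val).
    rewrite /= (cocycle_torsionE (valZ x)) E => /eqP; rewrite subr_eq0 -mulrnA -vE => /eqP E'.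
    exact: (Z_B_invariants (valZ x) (esym E') E).
  have [ga [E E1]] := B_invariants xB; congr (_, _).
    by apply/eqP; rewrite quo_multiples_class_eq0; apply/asboolP; exists ga.
  by apply: val_inj; rewrite /= (cocycle_torsionE (valZ x)) E E1 -mulrnA -vE subrr.
have phi_surj w : exists x, phi x = w.
  case: w => c d; have [g1 <-] := quo_multiples_class_surj c.
  have rel := torsion_rel g1 d.
  exists (Subgp (zco_in_Z rel)); rewrite /phi /= ; have [E E1] := zco_invariants rel.
  congr (_, _); first by rewrite E1.
  by apply: val_inj; rewrite cocycle_torsionE ?zco_in_Z // E E1 subKr.
have [Theta' [Theta'_bij Theta'E]] := subquot_isog phiB phi_ker phi_surj.
split; first by exists Theta'.
pose th (x : subgp Zbar) : (G * torsion G u)%type :=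
  (invariant_ga1 (val x), cocycle_torsion (val x)).
have thB : zmod_morphism th.
  move=> x y; rewrite /th raddfB /= invariant_ga1B.
  by rewrite (cocycle_torsionB (valZbarZ x) (valZbarZ y)).
have [Theta ThetaE] := mk_additive thB.
have thz (x : subgp Zbar) (ga1 ga : G) : ga1 *+ v = ga *+ u -> val x = z ga1 ga ->
    (Theta x).1 = ga1 /\ subgp_val (Theta x).2 = ga1 *+ t - ga.
  move=> rel E; rewrite ThetaE /= -[subgp_val _]/(val _) (cocycle_torsionE (valZbarZ x)).
  by rewrite E; have [-> ->] := zco_invariants rel.
exists Zbar; split=> //.
- move=> c; have [y <-] := subquot_class_surj c.
  have rel := invariants_rel (valZ y); have [r r0 E] := cocycle_decomp (valZ y).
  exists (Subgp (zco_in_Z rel)); split; first by apply/ZbarP; do 2!eexists; split; [exact: rel|].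
  apply/eqP; rewrite -subr_eq0 -subquot_classB subquot_class_eq0 raddfB /=.
  by rewrite [X in _ - X]E opprD addNKr rpredN; apply/asboolP; exists r.
- move=> x; split=> [/andP[xB /ZbarP[a1 [a [rel xE]]]]|[ga ->]].
    have [ga [E E1]] := B_invariants xB; have [E' E1'] := zco_invariants rel.
    by exists ga; rewrite xE -E -E1 xE E' E1'.
  rewrite zco_B /=; apply/ZbarP; exists (ga *+ u), (ga *+ v); split=> //.
  by rewrite -!mulrnA mulnC.
exists Theta; split=> //.
  apply: inj_surj_bij => [x y|[g1 d]].
    have /ZbarP[a1 [a [ra xE]]] := valZbar x; have /ZbarP[b1 [b [rb yE]]] := valZbar y.
    have [E1 E2] := thz _ _ _ ra xE; have [E3 E4] := thz _ _ _ rb yE.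
    move=> E; apply: val_inj; rewrite xE yE; move: E2; rewrite -E1 E E3 E4.
    by move=> /addrI/oppr_inj ->.
  have rel := torsion_rel g1 d.
  have zZ : z g1 (g1 *+ t - val d) \in Zbar by apply/ZbarP; do 2!eexists; split; [exact: rel|].
  exists (Subgp zZ); have [E1 E2] := thz (Subgp zZ) _ _ rel erefl.
  move: E1 E2; case: (Theta _) => a b /= -> E2; congr (_, _).
  by apply: val_inj; rewrite /= E2 subKr.
exists Theta'; split=> // x y E.
by rewrite Theta'E ThetaE /phi /th /= E.
Qed.

(** * Sums along orbits of 1 - u, and the enumeration of Z/v by powers of 1 *)

Definition orbit_sum (al : 'Z_v -> G) (n : nat) (i : 'Z_v) : G :=
  \sum_(0 <= s < n) al ((1 - (s * u)%:R) * i).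

Lemma sub_u_mul n m :
  (1 - (n * u)%:R) * (1 - (m * u)%:R) = 1 - ((n + m) * u)%:R :> 'Z_v.
Proof.
rewrite mulnDl natrD !natrM; have := Zv_uu0.
by move: (u%:R : 'Z_v) (n%:R : 'Z_v) (m%:R : 'Z_v) => a b c aa; ring: aa.
Qed.

Lemma sub_uS n : (1 - u%:R) * (1 - (n * u)%:R) = 1 - (n.+1 * u)%:R :> 'Z_v.
Proof. by have := sub_u_mul 1 n; rewrite mul1n. Qed.

Lemma sub_tu : 1 - (t * u)%:R = 1 :> 'Z_v.
Proof. by rewrite mulnC -vE Zv_v0 subr0. Qed.

Section OrbitSum.
Variable al : 'Z_v -> G.

Lemma orbit_sum0 i : orbit_sum al 0 i = 0.
Proof. by rewrite /orbit_sum big_geq. Qed.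

Lemma orbit_sumS n i : orbit_sum al n.+1 i = orbit_sum al n i + al ((1 - (n * u)%:R) * i).
Proof. by rewrite /orbit_sum big_nat_recr. Qed.

Lemma orbit_sum1 i : orbit_sum al 1 i = al i.
Proof. by rewrite orbit_sumS orbit_sum0 add0r mul0n subr0 mul1r. Qed.

Lemma orbit_sumD n m i :
  orbit_sum al (n + m) i = orbit_sum al n i + orbit_sum al m ((1 - (n * u)%:R) * i).
Proof.
elim: m => [|m IH]; first by rewrite addn0 orbit_sum0 addr0.
by rewrite addnS !orbit_sumS IH mulrA sub_u_mul addrA [(m + n)%N]addnC.
Qed.

Lemma orbit_sum_t k i : orbit_sum al (t * k) i = norm al i *+ k.
Proof.
elim: k => [|k IH]; first by rewrite muln0 orbit_sum0.
by rewrite mulnS orbit_sumD sub_tu mul1r IH mulrS.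
Qed.

Hypothesis alu : forall i, norm al i *+ u = 0.

(** The orbit repeats after t steps, so v = t u consecutive terms contribute u times the norm, which
    is 0. *)
Lemma orbit_sum_mod n i : orbit_sum al n i = orbit_sum al (n %% v) i.
Proof.
rewrite {1}(divn_eq n v) addnC orbit_sumD.
have -> : (n %/ v * v = t * (u * (n %/ v)))%N by rewrite vE; lia.
by rewrite orbit_sum_t mulrnA alu mul0rn addr0.
Qed.

Lemma norm_unit i : norm al ((1 - u%:R) * i) = norm al i.
Proof.
have E n : norm al ((1 - (n * u)%:R) * i) = orbit_sum al (n + t) i - orbit_sum al n i.
  by rewrite orbit_sumD addrAC subrr add0r.
by rewrite -{1}[u]mul1n E addnC orbit_sumD sub_tu mul1r addrK.
Qed.
End OrbitSum.

(** The compatibility equation is summed along the orbit; the terms in F telescope. *)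
Lemma orbit_sum_cocycle (F : 'Z_v * 'Z_v -> G) (al : 'Z_v -> G) :
  (forall i j, al i + al j - al (i + j) + F ((1 - u%:R) * i, (1 - u%:R) * j)
     - F (i, j) = 0) ->
  forall n i j, F ((1 - (n * u)%:R) * i, (1 - (n * u)%:R) * j) - F (i, j)
    + orbit_sum al n j - orbit_sum al n (i + j) + orbit_sum al n i = 0.
Proof.
move=> H; elim=> [|n IH] i j.
  by rewrite mul0n subr0 !mul1r !orbit_sum0; zmod.
rewrite !orbit_sumS mulrDr; have E1 := IH i j.
have := H ((1 - (n * u)%:R) * i) ((1 - (n * u)%:R) * j); rewrite !mulrA sub_uS => E2.
by have := congr2 +%R E1 E2; rewrite addr0 => E; rewrite -[RHS]E; zmod.
Qed.

(* sigma(n) acts on Z/v as the n-th power of 1, namely as 1 - n u, so that n |->  *)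
(* sigma(n) is the orbit of 0 under a |-> a + (1 - u a)^-1.                       *)
Definition sigma n := (n + u * 'C(n, 2))%N.

Lemma sigma0 : sigma 0 = 0%N.
Proof. by rewrite /sigma bin_small // muln0. Qed.

Lemma sigma1 : sigma 1 = 1%N.
Proof. by rewrite /sigma bin_small // muln0. Qed.

Lemma sigma_act n : 1 - u%:R * (sigma n)%:R = 1 - (n * u)%:R :> 'Z_v.
Proof.
rewrite /sigma natrD mulrDr !natrM mulrA Zv_uu0 mul0r addr0.
by rewrite [u%:R * _]mulrC.
Qed.

(** The addition law of powers of 1: the factor 1 + n u is the inverse of 1 - n u, since u^2 = 0
    modulo v. *)
Lemma sigmaD n m :
  (sigma (n + m))%:R = (sigma n)%:R + (1 + (n * u)%:R) * (sigma m)%:R :> 'Z_v.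
Proof.
have C : ('C(n + m, 2) = 'C(n, 2) + 'C(m, 2) + n * m)%N.
  elim: m => [|m IH]; first by rewrite addn0 muln0 !addn0.
  by rewrite addnS !binS !bin1 IH mulnS; lia.
rewrite /sigma C !(natrD, natrM); have := Zv_uu0.
by move: (u%:R : 'Z_v) (n%:R : 'Z_v) (m%:R : 'Z_v) ('C(n, 2)%:R : 'Z_v)
  ('C(m, 2)%:R : 'Z_v) => a b c x y aa; ring: aa.
Qed.

Lemma odd_v : ~~ odd u || odd v.
Proof.
by rewrite vE oddM; case ou : (odd u) => //=; move: ou; rewrite uE oddM => /andP[].
Qed.

Lemma sigma_v : (sigma v)%:R = 0 :> 'Z_v.
Proof.
have C2 := bin2_mul2 v.
suff /dvdnP[k kE] : (v %| u * 'C(v, 2))%N.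
  by rewrite /sigma natrD kE natrM Zv_v0 mulr0 addr0.
have [ou|eu] := boolP (odd u).
  have ov : odd v by have := odd_v; rewrite ou.
  apply: dvdn_mull; rewrite -(@Gauss_dvdl _ _ 2) ?C2 ?dvdn_mulr //.
  by rewrite coprimen2.
have -> : (u * 'C(v, 2) = v * (u./2 * (v - 1)))%N.
  have uh : (u = u./2 * 2)%N by rewrite muln2 even_halfK.
  by rewrite {1}uh -mulnA [(2 * _)%N]mulnC C2; lia.
exact: dvdn_mulr.
Qed.

(** First u | d. For odd u, u then divides C(d, 2) and v | u^2 removes that term. For u = 4k and d =
    e u, sigma(d) = u e (1 + 2k(d - 1)), whose last factor is prime to t, so t | e. *)
Lemma sigma_eq0 d : (sigma d)%:R = 0 :> 'Z_v -> (v %| d)%N.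
Proof.
move=> E; have {E} vd : (v %| sigma d)%N.
  by have := (Zv_natP (sigma d) 0).2 E; rewrite mod0n => /eqP.
have ud : (u %| d)%N.
  have : (u %| sigma d)%N by apply: dvdn_trans vd; rewrite vE dvdn_mulr.
  by rewrite /sigma dvdn_addl // dvdn_mulr.
have vuu : (v %| u * u)%N by rewrite uuE dvdn_mull.
case/dvdnP: ud => e dE.
have C2 := bin2_mul2 d.
have [ou|eu] := boolP (odd u).
  have uC : (u %| 'C(d, 2))%N.
    by rewrite -(@Gauss_dvdl _ _ 2) ?C2 ?coprimen2 // {1}dE -mulnA dvdn_mull // dvdn_mulr.
  move: vd; rewrite /sigma dvdn_addl //.
  by apply: dvdn_trans vuu _; rewrite dvdn_pmul2l //; lia.
have u4 : (4 %| u)%N by case/orP: par => [|/andP[]//]; rewrite (negbTE eu).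
case/dvdnP: u4 => k kE.
have CE : ('C(d, 2) = 2 * k * e * (d - 1))%N.
  by have : (d * (d - 1) = 2 * k * e * (d - 1) * 2)%N; [rewrite {1}dE kE; lia|lia].
have sE : (sigma d = u * (e * (1 + 2 * k * (d - 1))))%N.
  by rewrite /sigma CE {1}dE; lia.
move: vd; rewrite sE vE dE dvdn_pmul2l; last by lia.
have co : coprime t (1 + 2 * k * (d - 1)).
  apply: (@coprime_dvdl _ (2 * k * 2)); first by rewrite -mulnA [(k * 2)%N]mulnC mulnA
    [(2 * 2 * k)%N]mulnC -kE uE dvdn_mulr.
  have c1 : coprime (2 * k) (1 + 2 * k * (d - 1)).
    by rewrite /coprime addnC [(2 * k * _)%N]mulnC gcdnMDl gcdn1.
  by rewrite coprimeMl c1 /= coprime2n oddD -mulnA oddM.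
rewrite mulnC Gauss_dvdr; last by rewrite -dE.
by rewrite [(e * u)%N]mulnC dvdn_pmul2l //; lia.
Qed.

(** By [sigmaD], equal values at n <= m make a unit multiple of sigma(m - n) vanish; so [sigma] is
    injective on the finite set Z/v, hence bijective. *)
Lemma sigma_surj : exists tau : 'Z_v -> nat,
  (forall a, a = (sigma (tau a))%:R) /\
  forall n, (tau (sigma n)%:R = n %[mod v])%N.
Proof.
have unit_n n (x : 'Z_v) : (1 + (n * u)%:R) * x = 0 -> x = 0.
  move=> E; have : (1 - (n * u)%:R) * ((1 + (n * u)%:R) * x) = 0 by rewrite E mulr0.
  rewrite mulrA natrM; have := Zv_uu0.
  move: (u%:R : 'Z_v) (n%:R : 'Z_v) => a b aa <-; by ring: aa.
have sig_mod n m : (n <= m)%N -> (sigma n)%:R = (sigma m)%:R :> 'Z_v -> (n = m %[mod v])%N.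
  move=> le; rewrite -(subnKC le) sigmaD -{1}[(sigma n)%:R]addr0 => /addrI/esym/unit_n.
  by move=> /sigma_eq0 /eqP E; rewrite -modnDmr E addn0.
have sig_modE n m : (sigma n)%:R = (sigma m)%:R :> 'Z_v -> (n = m %[mod v])%N.
  by have [le|/ltnW le] := leqP n m; [exact: sig_mod|move=> /esym/(sig_mod _ _ le)].
pose sg (i : 'Z_v) : 'Z_v := (sigma i)%:R.
have sgI : injective sg.
  by move=> i j /sig_modE/Zv_natP; rewrite !natr_Zp.
have [g gK Kg] := injF_bij sgI.
exists (fun a => nat_of_ord (g a)); split=> [a|n]; first by rewrite -/(sg (g a)) Kg.
by apply: sig_modE; rewrite -/(sg (g _)) Kg.
Qed.

(** * Restriction of full cocycles to the small complex *)

Local Notation dot := (@cyc_op u v).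
Local Notation Z2 := (@Zpred 'Z_v dot G 2).
Local Notation B2 := (@Bpred 'Z_v dot G 2).

(** The third component is the only one possible, by [cocycle_beta]. *)
Definition restr_cochain (f : Tot 'Z_v 2 -> G) : X2 v G :=
  ([ffun ij => val_sym f ij.1 ij.2], [ffun i => val_act f 1 i],
   [ffun i => - norm (val_act f 1) i *+ (1 + w)]).

Lemma restr_cochainB : zmod_morphism restr_cochain.
Proof.
move=> f g; apply: X2_eq; apply/ffunP => i; rewrite !ffunE //=.
rewrite -mulrnBl -opprD; congr (- _ *+ _).
by rewrite /norm -sumrB.
Qed.

Lemma val_act_sigma f : f \in Z2 ->
  forall n i, val_act f (sigma n)%:R i = orbit_sum (val_act f 1) n i.
Proof.
move=> fZ; have fH : f \in @Hom_pred 'Z_v G 2 by case/andP: fZ.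
have [_ _ H2] := (Zpred2P dot fH).1 fZ.
elim=> [|n IH] i; first by rewrite orbit_sum0 sigma0 val_act0l.
(* The second argument is chosen so that sigma(n) carries it to 1 and adding it to sigma(n) gives
   sigma(n + 1). *)
have := H2 (sigma n)%:R (1 + (n * u)%:R) i.
have -> : (sigma n)%:R + (1 + (n * u)%:R) = (sigma n.+1)%:R :> 'Z_v.
  by have := sigmaD n 1; rewrite addn1 sigma1 mulr1 => ->.
rewrite /cyc_op sigma_act.
have -> : (1 - (n * u)%:R) * (1 + (n * u)%:R) = 1 :> 'Z_v.
  have := Zv_uu0; rewrite natrM; move: (u%:R : 'Z_v) (n%:R : 'Z_v) => a b aa.
  by ring: aa.
by rewrite orbit_sumS -IH => E; rewrite -[RHS]subr0 -E; zmod.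
Qed.

(** As v = t u, the left side is A(sigma(v); i) = A(0; i). *)
Lemma val_act_norm f : f \in Z2 -> forall i, norm (val_act f 1) i *+ u = 0.
Proof.
move=> fZ i; have fH : f \in @Hom_pred 'Z_v G 2 by case/andP: fZ.
by rewrite -orbit_sum_t mulnC -vE -val_act_sigma // sigma_v val_act0l.
Qed.

Lemma restr_cochain_in_Z f : f \in Z2 -> restr_cochain f \in Z.
Proof.
move=> fZ; have fH : f \in @Hom_pred 'Z_v G 2 by case/andP: fZ.
have [H0 H1 H2] := (Zpred2P dot fH).1 fZ.
have Nu := val_act_norm fZ.
have alE i j : val_act f 1 i + val_act f 1 j - val_act f 1 (i + j)
    + val_sym f ((1 - u%:R) * i) ((1 - u%:R) * j) - val_sym f i j = 0.
  by have := H1 1 i j; rewrite /cyc_op mulr1 => E; rewrite -[RHS]E; zmod.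
have N0 : norm (val_act f 1) 0 = 0.
  by rewrite /norm big1 // => s _; rewrite mulr0 val_act0r.
have ND i j : norm (val_act f 1) (i + j) = norm (val_act f 1) i + norm (val_act f 1) j.
  have := orbit_sum_cocycle (F := fun ij => val_sym f ij.1 ij.2) alE t i j.
  rewrite sub_tu !mul1r => E; apply/eqP; rewrite eq_sym -subr_eq0; apply/eqP.
  by rewrite -[RHS]E -!/(norm _ _); zmod.
have NL := norm_unit (val_act f 1).
have NLn n i : norm (val_act f 1) ((1 - (n * u)%:R) * i) = norm (val_act f 1) i.
  elim: n => [|n IH]; first by rewrite mul0n subr0 mul1r.
  by rewrite -[RHS]IH -[RHS]NL mulrA sub_uS.
apply/asboolP; split; split.
- by move=> i j; rewrite !ffunE val_symC.
- by move=> j; rewrite ffunE val_sym0.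
- by rewrite ffunE val_act0r.
- by rewrite ffunE N0 oppr0 mul0rn.
- by move=> a b c; rewrite !ffunE /=; have := H0 a b c => E; rewrite -[RHS]oppr0 -[in RHS]E; zmod.
- by move=> i j; rewrite !ffunE alE.
- by move=> i j; rewrite !ffunE ND opprD mulrnDl.
- move=> i; rewrite !ffunE NL; split=> //.
  by rewrite mulrnAC mulNrn Nu oppr0 mul0rn.
move=> i.
under [X in - X]eq_bigr do rewrite ffunE.
under [X in _ + X *+ _]eq_bigr do rewrite ffunE NLn.
rewrite sumrMnr sum1_bin2 ffunE -/(norm _ _).
(* The left side of the last equation collapses to - w^2 times the norm. *)
have := mulrn_w_sq (Nu i); move: (norm _ i) (u') 'C(t, 2) => y a c E.
by rewrite -[RHS]oppr0 -[in RHS]E; zmod.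
Qed.

(** If alpha is the coboundary of [th], its orbit sums telescope to th(a . b) - th(b) for a =
    sigma(n), hence for every a. *)
Lemma restr_cochain_B f : f \in Z2 -> (restr_cochain f \in B) = (f \in B2).
Proof.
move=> fZ; have fH : f \in @Hom_pred 'Z_v G 2 by case/andP: fZ.
have rZ := restr_cochain_in_Z fZ.
apply/idP/idP => [/asboolP[th [th0 E]]|/(Bpred2P dot fH)[th [th0 sE aE]]].
  apply/(Bpred2P dot fH).
  have sE a b : val_sym f a b = th (a + b) - th a - th b.
    by have := congr1 (fun x : X2 v G => x.1.1 (a, b)) E; rewrite !ffunE.
  have alE a : val_act f 1 a = th ((1 - u%:R) * a) - th a.
    by have := congr1 (fun x : X2 v G => x.1.2 a) E; rewrite !ffunE.
  exists th; split=> // a b; have [tau [tauE _]] := sigma_surj.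
  rewrite (tauE a) val_act_sigma // /cyc_op sigma_act; elim: (tau a) => [|n IH].
    by rewrite orbit_sum0 mul0n subr0 mul1r subrr.
  rewrite orbit_sumS IH alE mulrA sub_uS.
  by move: (th _) (th _) (th _) => x y z; zmod.
apply/asboolP; exists [ffun i => th i]; split; first by rewrite ffunE.
apply: cocycle_eq => //; first by apply: X2_d_in_Z; rewrite ffunE.
  by case=> i j; rewrite !ffunE sE.
by move=> i; rewrite !ffunE aE /cyc_op mulr1.
Qed.

(** A is defined by orbit sums of alpha. Since u beta = 0 forces u times the norm to vanish,
    A(sigma(n); _) depends on n modulo v only. *)
Lemma restr_cochain_surj x : x \in Z -> exists2 f, f \in Z2 & restr_cochain f = x.
Proof.
move=> xZ; have [Fs F0 FZ alE] := cocycleP xZ.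
have [tau [tauE tauM]] := sigma_surj.
have Nu i : norm x.1.2 i *+ u = 0.
  have [-> bu] := cocycle_norm i xZ.
  by rewrite mulrnBl mulrnAC bu mul0rn subrr.
have a0 : x.1.2 0 = 0.
  have := alE 0 0; rewrite !mulr0 addr0 => E; rewrite -[RHS]E; zmod.
pose A a c := orbit_sum x.1.2 (tau a) c.
have AE n c : A (sigma n)%:R c = orbit_sum x.1.2 n c.
  by rewrite /A orbit_sum_mod // tauM -orbit_sum_mod.
have A0l a : A 0 a = 0.
  by have := AE 0%N a; rewrite orbit_sum0 sigma0.
have A0r a : A a 0 = 0.
  by rewrite /A /orbit_sum big1 // => s _; rewrite mulr0.
have [f fH [fF fA]] := @Hom2_exists 'Z_v G (fun a b => x.1.1 (a, b)) A F0 Fs A0l A0r.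
have fZ : f \in Z2.
  apply/(Zpred2P dot fH); rewrite /val_sym /val_act; split=> a b c; rewrite ?fF ?fA.
  - by have := FZ a b c => E; rewrite -[RHS]oppr0 -[in RHS]E; zmod.
  - rewrite (tauE a) !AE /cyc_op sigma_act.
    by have := orbit_sum_cocycle (F := x.1.1) alE (tau a) b c; move=> E; rewrite -[RHS]E; zmod.
  rewrite (tauE a); set n := tau a; rewrite /cyc_op sigma_act.
  (* In this form [sigmaD] identifies a + b with sigma(n + m), where a . b = sigma(m), and the
     identity becomes [orbit_sumD]. *)
  have bE : b = (1 + (n * u)%:R) * ((1 - (n * u)%:R) * b).
    have := Zv_uu0; rewrite mulrA natrM; move: (u%:R : 'Z_v) (n%:R : 'Z_v) => p q pp.
    by ring: pp.
  rewrite {2}bE; move: ((1 - (n * u)%:R) * b) => b'.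
  rewrite (tauE b') -sigmaD !AE orbit_sumD; zmod.
exists f => //; apply: cocycle_eq => //; first exact: restr_cochain_in_Z.
  by case=> a b; rewrite ffunE /= /val_sym fF.
move=> a; rewrite ffunE /val_act fA.
by have := AE 1%N a; rewrite orbit_sum1 sigma1.
Qed.

Lemma full_small_isog : zmod_isog (HN dot G 2) (H2X u v t u' G).
Proof.
have rZ (f : subgp Z2) : restr_cochain (val f) \in Z.
  by apply: restr_cochain_in_Z; exact: valP.
pose phi (f : subgp Z2) : H2X u v t u' G := subquot_class B (Subgp (rZ f)).
have phiB : zmod_morphism phi.
  move=> f g; rewrite /phi -subquot_classB; congr subquot_class.
  by apply: val_inj; exact: restr_cochainB.
have phi_ker f : (phi f == 0) = (val f \in B2).
  by rewrite /phi subquot_class_eq0 restr_cochain_B //; exact: valP.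
have phi_surj c : exists f, phi f = c.
  have [x <-] := subquot_class_surj c; have xZ : val x \in Z by exact: valP.
  have [f fZ fx] := restr_cochain_surj xZ; exists (Subgp fZ).
  by congr subquot_class; apply: val_inj.
have [F [Fbij _]] := subquot_isog phiB phi_ker phi_surj.
by exists F.
Qed.
End SmallComplexTheory.

Theorem theorem3p16 (p nu eta u v t u' : nat) (G : zmodType) :
  prime p -> (0 < nu)%N -> (nu <= eta)%N -> (eta <= 2 * nu)%N ->
  u = (p ^ nu)%N -> v = (p ^ eta)%N ->
  t = (p ^ (eta - nu))%N -> u' = (p ^ (2 * nu - eta))%N ->
  (2 < u)%N -> (u < v)%N -> (v <= u ^ 2)%N ->
  let X := X2 v G in
  let Z := X2_Z u v t u' G in
  let B := X2_B u v G in
  let H2 := H2X u v t u' G in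
  let z := zco u v t u' G in
  [/\ zmod_isog (HN (@cyc_op u v) G 2) H2,
      zmod_isog H2 (quo_multiples G u * torsion G u)%type &
      exists Zbar : zmodClosed X,
        [/\ forall x : X, x \in Zbar <->
              exists ga1 ga : G, ga1 *+ v = ga *+ u /\ x = z ga1 ga,
            {subset Zbar <= Z},
            forall c : H2, exists x : subgp Z,
              val x \in Zbar /\ subquot_class B x = c,
            forall x : X, (x \in B) && (x \in Zbar) <->
              exists ga : G, x = z (ga *+ u) (ga *+ v) &
            exists Theta : {additive subgp Zbar -> (G * torsion G u)%type},
              [/\ forall (x : subgp Zbar) (ga1 ga : G),
                    ga1 *+ v = ga *+ u -> val x = z ga1 ga ->
                    (Theta x).1 = ga1 /\ subgp_val (Theta x).2 = ga1 *+ t - ga,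
                  bijective Theta &
                  exists Theta' : {additive H2 -> (quo_multiples G u * torsion G u)%type},
                    bijective Theta' /\
                    forall (x : subgp Zbar) (y : subgp Z), val y = val x ->
                      Theta' (subquot_class B y) =
                        (quo_multiples_class u (Theta x).1, (Theta x).2)]]].
Proof.
move=> pr nu0 nu_eta eta_nu uE vE tE u'E u_gt2 u_lt_v v_le X Z B H2 z.
have nu_lt : (nu < eta)%N.
  by rewrite -(ltn_exp2l _ _ (prime_gt1 pr)) -uE -vE.
have t_gt1 : (1 < t)%N by rewrite tE -(expn0 p) ltn_exp2l ?prime_gt1 // subn_gt0.
have uE' : u = (t * u')%N by rewrite uE tE u'E -expnD; congr (_ ^ _)%N; lia.
have vE' : v = (u * t)%N by rewrite vE uE tE -expnD; congr (_ ^ _)%N; lia.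
(* For odd p, u is odd. For p = 2, u > 2 gives nu >= 2, so 4 | u, and nu < eta makes t even. *)
have par : odd u || ((4 %| u)%N && ~~ odd t).
  have [p2|p_odd] := even_prime pr; last by rewrite uE oddX p_odd orbT.
  have nu2 : (2 <= nu)%N by move: u_gt2; rewrite uE p2; case: (nu) => [|[|]].
  apply/orP; right; rewrite uE tE p2 oddX subn_eq0 leqNgt nu_lt andbT.
  exact: (@dvdn_exp2l 2 2).
have [H2iso rest] := small_complex_cohomology G t_gt1 u_gt2 uE' vE' par.
by split=> //; exact: full_small_isog.
Qed.
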